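(* Let $p>5$ be a prime and $r$ a positive integer. Then \[ \sum_{\substack{i_{1}+\cdots+i_{5}=2p^{r}\\ i_{1},\dots,i_{5}\in \mathcal{P}_{p}}}\frac{(-1)^{i_{1}}}{i_{1}i_{2}i_{3}i_{4}i_{5}}+2\sum_{\substack{i_{1}+\cdots+i_{5}=2p^{r}\\ i_{1},\dots,i_{5}\in \mathcal{P}_{p}}}\frac{(-1)^{i_{1}+i_{2}}}{i_{1}i_{2}i_{3}i_{4}i_{5}} \equiv\begin{cases} 12B_{p-5}\pmod{p}, & \text{if } r=1,\\ 6p^{r-1}B_{p-5}\pmod{p^{r}}, & \text{if } r>1. \end{cases} \]
   Context: $\mathcal{P}_{n}$ denotes the set of positive integers coprime to $n$; the sums run over ordered 5-tuples of positive integers, each coprime to $p$, with the indicated sum. The Bernoulli numbers $B_k$ are defined by $B_0=1$ and $\sum_{i=0}^{n}\binom{n+1}{i}B_{i}=0$ for $n\geq 1$. Congruences between rational numbers whose denominators are coprime to $p$ are understood in the ring of $p$-integral rationals: $a\equiv b \pmod{p^s}$ means $(a-b)/p^s$ has denominator coprime to $p$. *)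

(* Defs.v *)
From mathcomp Require Import all_boot all_order all_algebra.
Set Implicit Arguments.
Unset Strict Implicit.
Unset Printing Implicit Defensive.
Import Order.TTheory GRing.Theory Num.Theory.
Local Open Scope ring_scope.

Definition coprime_pos (n : nat) : pred nat :=
  fun i => (0 < i)%N && coprime i n.

(* B_0, ..., B_(n-1): the defining relation is solved for its last term, since
   \sum_(i < m.+1) 'C(m.+1, i) B_i equals 1 for m = 0 and 0 for m >= 1. *)
Fixpoint bernoulli_seq (n : nat) : seq rat :=
  if n is m.+1 then
    let s := bernoulli_seq m in
    rcons s (((m == 0%N)%:R - \sum_(i < m) 'C(m.+1, i)%:R * s`_i) / m.+1%:R)
  else [::].

Definition bernoulli (n : nat) : rat := (bernoulli_seq n.+1)`_n.

Lemma size_bernoulli_seq n : size (bernoulli_seq n) = n.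
Proof. by elim: n => //= n IHn; rewrite size_rcons IHn. Qed.

Lemma nth_bernoulli_seq n i : (i < n)%N -> (bernoulli_seq n)`_i = bernoulli i.
Proof.
elim: n => // n IHn; rewrite ltnS leq_eqVlt => /predU1P[-> // | lt_in].
by rewrite /= nth_rcons size_bernoulli_seq lt_in IHn.
Qed.

Lemma bernoulliE n : \sum_(i < n.+1) 'C(n.+1, i)%:R * bernoulli i = (n == 0%N)%:R.
Proof.
rewrite big_ord_recr /= binSn.
rewrite {2}/bernoulli /= nth_rcons size_bernoulli_seq ltnn eqxx.
rewrite mulrC divfK ?pnatr_eq0 //.
rewrite (eq_bigr (fun i : 'I_n => 'C(n.+1, i)%:R * (bernoulli_seq n)`_i)).
  by rewrite addrC subrK.
by move=> i _; rewrite nth_bernoulli_seq.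
Qed.

Lemma bernoulli0 : bernoulli 0 = 1.
Proof. by have := bernoulliE 0; rewrite big_ord1 bin0 mul1r. Qed.

Lemma bernoulli_rec n :
  (1 <= n)%N -> \sum_(i < n.+1) 'C(n.+1, i)%:R * bernoulli i = 0.
Proof. by case: n => // n _; rewrite bernoulliE. Qed.

Definition eqmodpq (p s : nat) (a b : rat) : Prop :=
  coprime `|denq ((a - b) / (p ^ s)%:R)|%N p.

(* A 5-tuple of positive integers of sum N has entries at most N, so bounding
   the entries by 'I_N.+1 loses nothing. The indices are 0, ..., 4, so that
   (i 0, i 1) stands for (i_1, i_2). *)
Definition sum5 (p N : nat) (w : {ffun 'I_5 -> 'I_N.+1} -> rat) : rat :=
  \sum_(i : {ffun 'I_5 -> 'I_N.+1}
        | [forall k, coprime_pos p (i k)] && (\sum_k (i k : nat) == N)%N)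
    w i / \prod_k (i k)%:R.

(* Main.v *)
(* Let Z(N) be the sum of 1/(i_1 ... i_5) over the 5-tuples of sum N with entries coprime
   to p, that is the coefficient of x^N in f^5 with f = \sum_(p does not divide i) x^i/i.
   Since f(x) + f(-x) = f(x^2), five times the signed sum is Z(p^r)/2 - Z(2 p^r).

   For r = 1, inclusion-exclusion on the entries divisible by p expresses Z(p) and Z(2p)
   through sums over all tuples, which are elementary symmetric functions of the
   reciprocals 1/i. Newton's identities turn these into power sums; pairing i with n - i
   and Fermat's little theorem reduce the power sums to p B_(p-5), and the outcome is
   Z(p) = -24 B_(p-5), Z(2p) = -72 B_(p-5) modulo p.

   For the step from q = p^r to p q, write i = a + q b with 0 < a < q. Expanding 1/i to
   first order in q gives Z(n q) = \sum_c 'C(n + 4 - c, 4) S_c modulo q, where S_c is the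
   part of the sum over tuples a of sum c q (1 <= c <= 4). If p divides n, the binomials
   are divisible by p and the congruence holds modulo p q. The symmetry a -> q - a gives
   S_(5-c) = - S_c modulo q, hence Z(m p q) = m p (8 Z(q) - Z(2 q))/6 modulo p q. *)
Require Import Defs.
From HB Require Import structures.
From mathcomp Require Import all_boot all_order all_algebra.
From mathcomp Require Import ring zify.
Set Implicit Arguments.
Unset Strict Implicit.
Unset Printing Implicit Defensive.
Import Order.TTheory GRing.Theory Num.Theory.
Local Open Scope ring_scope.

(** * Symmetric functions *)

Section SymmetricFunctions.

Variable R : comNzRingType.
Implicit Types (x : R) (s t : seq R).

Definition elem_sym s k : R := (\prod_(x <- s) (1 + x *: 'X))`_k.

Definition power_sum s k : R := \sum_(x <- s) x ^+ k.

Lemma elem_sym0 s : elem_sym s 0 = 1.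
Proof.
rewrite /elem_sym; elim: s => [|x s IHs]; first by rewrite big_nil coef1.
by rewrite big_cons coef0M IHs coefD coefZ coefX coef1 mulr0 addr0 mulr1.
Qed.

Lemma elem_symS_nil k : elem_sym [::] k.+1 = 0.
Proof. by rewrite /elem_sym big_nil coef1. Qed.

Lemma elem_symS_cons x s k : elem_sym (x :: s) k.+1 = elem_sym s k.+1 + x * elem_sym s k.
Proof. by rewrite /elem_sym big_cons mulrDl mul1r coefD -scalerAl coefZ coefXM. Qed.

Lemma perm_elem_sym s t k : perm_eq s t -> elem_sym s k = elem_sym t k.
Proof. by move=> st; rewrite /elem_sym (perm_big _ st). Qed.

Lemma elem_sym_behead x s k :
  \sum_(i < k.+1) (-1) ^+ i * elem_sym (x :: s) (k - i) * x ^+ i = elem_sym s k.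
Proof.
elim: k => [|k IHk]; first by rewrite big_ord1 !elem_sym0 !mulr1.
rewrite big_ord_recl mulr1 mul1r subn0 elem_symS_cons.
rewrite (eq_bigr (fun i : 'I_k.+1 =>
    - (x * ((-1) ^+ i * elem_sym (x :: s) (k - i) * x ^+ i)))).
  by rewrite sumrN -mulr_sumr IHk addrK.
by move=> i _; rewrite lift0 subSS !exprS; ring.
Qed.

Lemma newton_identity s k :
  k%:R * elem_sym s k = \sum_(i < k) (-1) ^+ i * elem_sym s (k - i.+1) * power_sum s i.+1.
Proof.
elim: s k => [|x s IHs] [|k]; rewrite ?big_ord0 ?mul0r //.
  by rewrite elem_symS_nil mulr0 big1 // => i _; rewrite /power_sum big_nil mulr0.
pose coef i : R := (-1) ^+ i * elem_sym (x :: s) (k - i).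
transitivity (\sum_(i < k.+1) coef i * power_sum s i.+1
    + x * \sum_(i < k.+1) coef i * x ^+ i).
  rewrite elem_sym_behead big_ord_recr /= /coef subnn elem_sym0.
  rewrite (eq_bigr (fun i : 'I_k =>
      (-1) ^+ i * elem_sym s (k.+1 - i.+1) * power_sum s i.+1
      + x * ((-1) ^+ i * elem_sym s (k - i.+1) * power_sum s i.+1))) => [|i _].
    rewrite big_split -mulr_sumr -IHs /= elem_symS_cons.
    have := IHs k.+1; rewrite big_ord_recr /= subnn elem_sym0 -natr1 => newton_s.
    by rewrite mulrDr addrAC -[RHS]addrA [RHS]addrAC newton_s; ring.
  by rewrite subSS -[(k - i)%N]prednK ?subn_gt0 // elem_symS_cons subnS; ring.
rewrite mulr_sumr -big_split; apply: eq_bigr => i _ /=.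
by rewrite subSS /power_sum big_cons exprS /coef; ring.
Qed.

End SymmetricFunctions.

(** * Powers and coefficients *)

Lemma exprD_order2 (R : comNzRingType) (S : subringClosed R) (x y : R) n :
  x \in S -> y \in S ->
  exists2 z, z \in S & (x + y) ^+ n = x ^+ n + x ^+ n.-1 * y *+ n + y ^+ 2 * z.
Proof.
move=> Sx Sy; elim: n => [|n [z Sz IHn]].
  by exists 0; rewrite ?rpred0 // mulr0n mulr0 !addr0.
exists (x ^+ n.-1 *+ n + (x + y) * z).
  by rewrite rpredD ?rpredMn ?rpredX // rpredM ?rpredD.
rewrite exprS IHn /=; case: n {IHn} => [|n]; first by rewrite !mulr0n; ring.
by rewrite /= !exprS; ring.
Qed.

Lemma sum_ord_widen (V : nmodType) m n (F : nat -> V) : (m <= n)%N ->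
  (forall i, (m <= i < n)%N -> F i = 0) -> \sum_(i < m) F i = \sum_(i < n) F i.
Proof.
move=> mn F0; rewrite (big_ord_widen n F mn) big_mkcond /=.
by apply: eq_bigr => i _; case: ltnP => // mi; rewrite F0 ?mi /=.
Qed.

Lemma hockey_stick n k : (\sum_(i < n.+1) 'C(i + k, k) = 'C(n + k.+1, k.+1))%N.
Proof.
elim: n => [|n IHn]; first by rewrite big_ord1 !add0n !binn.
by rewrite big_ord_recr /= IHn (addSnnS n k) [in RHS]addSn binS.
Qed.

Section Coefficients.

Variable R : comNzRingType.
Implicit Types (P Q : {poly R}) (F : nat -> R).

Lemma coef_prod_poly m n N (F : 'I_m -> nat -> R) :
  (\prod_k \poly_(i < n) F k i)`_N
    = \sum_(f : {ffun 'I_m -> 'I_n} | (\sum_k (f k : nat) == N)%N)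
        \prod_k F k (f k).
Proof.
under eq_bigr => k _ do rewrite poly_def.
rewrite bigA_distr_bigA coef_sum [RHS]big_mkcond /=; apply: eq_bigr => f _.
rewrite scaler_prod -expr_sum coefZ coefXn eq_sym.
by case: eqP => _; rewrite ?mulr1 ?mulr0.
Qed.

Lemma coef_expr_rev k n N F : (N <= k * n)%N ->
  ((\poly_(i < n.+1) F i) ^+ k)`_N
    = ((\poly_(i < n.+1) F (n - i)%N) ^+ k)`_(k * n - N).
Proof.
move=> N_le; have prodX (P : {poly R}) : P ^+ k = \prod_(i < k) P.
  by rewrite prodr_const card_ord.
have sum_n : (\sum_(i < k) n = k * n)%N by rewrite sum_nat_const card_ord.
rewrite !prodX !coef_prod_poly.
pose rev (f : {ffun 'I_k -> 'I_n.+1}) : {ffun 'I_k -> 'I_n.+1} :=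
  [ffun i => rev_ord (f i)].
have revK : involutive rev by move=> f; apply/ffunP=> i; rewrite !ffunE rev_ordK.
rewrite (reindex_inj (can_inj revK)) /=; apply: eq_big => f; last first.
  by move=> _; apply: eq_bigr => i _; rewrite ffunE /= subSS.
have f_le i : (f i <= n)%N by rewrite -ltnS.
have -> : (\sum_i rev f i = k * n - \sum_i f i)%N.
  rewrite -sum_n -sumnB //.
  by apply: eq_bigr => i _; rewrite ffunE /= subSS.
have : (\sum_i f i <= k * n)%N by rewrite -sum_n leq_sum.
by move: (\sum_i f i)%N => m m_le; apply/eqP/eqP; lia.
Qed.

Lemma coef_expr_trunc P Q N k i :
  (forall j, (j <= N)%N -> P`_j = Q`_j) -> (i <= N)%N -> (P ^+ k)`_i = (Q ^+ k)`_i.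
Proof.
move=> PQ; elim: k i => [|k IHk] i iN //; rewrite !exprS !coefM.
apply: eq_bigr => j _; rewrite PQ ?IHk //; have := ltn_ord j; lia.
Qed.

Lemma coef_expr_lt P k i : P`_0 = 0 -> (i < k)%N -> (P ^+ k)`_i = 0.
Proof.
move=> P0; elim: k i => [|k IHk] i //; rewrite ltnS => ik.
rewrite exprS coefM big1 // => -[[|j] ji] _ /=; first by rewrite P0 mul0r.
by rewrite IHk ?mulr0 //; lia.
Qed.

Lemma coef_comp_polyN P i : (P \Po (- 'X))`_i = (-1) ^+ i * P`_i.
Proof.
rewrite comp_polyE -[in RHS](coefK P) coef_poly.
rewrite (eq_bigr (fun j : 'I_(size P) => ((-1) ^+ j * P`_j) *: 'X^j)).
  rewrite -(poly_def _ (fun j => (-1) ^+ j * P`_j)) coef_poly.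
  by case: ifP; rewrite ?mulr0.
by move=> j _; rewrite -[- 'X]scaleN1r exprZn scalerA mulrC.
Qed.

Lemma coef_mul_comp_Xn P Q d n : (0 < d)%N ->
  (P * (Q \Po 'X^d))`_(n * d) = \sum_(i < n.+1) P`_(i * d) * Q`_(n - i).
Proof.
move=> d_gt0; rewrite comp_polyE mulr_sumr coef_sum.
pose F j := if (j <= n)%N then P`_((n - j) * d) * Q`_j else 0.
transitivity (\sum_(j < size Q) F j).
  apply: eq_bigr => j _; rewrite -scalerAr coefZ -exprM coefMXn /F mulrC.
  rewrite [(d * j)%N]mulnC ltn_pmul2r // ltnNge mulnBl.
  by case: leqP => //= _; rewrite mul0r.
pose M := maxn (size Q) n.+1.
rewrite (@sum_ord_widen _ _ M) ?leq_maxl //; last first.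
  by move=> i /andP[Qi _]; rewrite /F [Q`_i]nth_default // mulr0 if_same.
rewrite -(@sum_ord_widen _ n.+1 M F) ?leq_maxr //; last first.
  by move=> i /andP[ni _]; rewrite /F leqNgt ni.
rewrite (reindex_inj rev_ord_inj) /=; apply: eq_bigr => i _.
by rewrite /F subSS leq_subr subKn // -ltnS.
Qed.

Lemma coef_mul_comp_Xn_small P Q d i : (0 < d)%N -> (size P <= d)%N ->
  (P * (Q \Po 'X^d))`_i = P`_(i %% d) * Q`_(i %/ d).
Proof.
move=> d_gt0 Pd; rewrite coefM.
have modi : (i %% d < i.+1)%N by rewrite ltnS leq_mod.
rewrite (bigD1 (Ordinal modi)) //= coef_comp_poly_Xn //.
have -> : (i - i %% d = i %/ d * d)%N by rewrite {1}(divn_eq i d) addnK.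
rewrite dvdn_mull // mulnK // big1 ?addr0 // => j jNmod.
have [dj|jd] := leqP d j; first by rewrite nth_default ?mul0r // (leq_trans Pd).
rewrite coef_comp_poly_Xn //; case: ifP; rewrite ?mulr0 // => d_dvd.
case/negP: jNmod; apply/eqP/val_inj => /=.
by rewrite -[LHS](modn_small jd); apply/eqP; rewrite eq_sym eqn_mod_dvd // -ltnS.
Qed.

Definition geom_poly n : {poly R} := \poly_(i < n) 1.

Lemma coef_geom_polyX n k i : (i < n)%N ->
  (geom_poly n ^+ k.+1)`_i = 'C(i + k, k)%:R.
Proof.
elim: k i => [|k IHk] i i_n; first by rewrite expr1 coef_poly i_n addn0 bin0.
rewrite exprSr coefM -hockey_stick natr_sum; apply: eq_bigr => j _.
rewrite IHk; last by have := ltn_ord j; lia.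
by rewrite coef_poly (_ : i - j < n)%N ?mulr1 //; lia.
Qed.

End Coefficients.

(** * Sums of reciprocals *)

Definition recips (p n : nat) : seq rat :=
  [seq i%:R^-1 | i <- index_iota 1 n & coprime i p].

Definition recip_poly (p n : nat) : {poly rat} :=
  \poly_(i < n) (if coprime i p then i%:R^-1 else 0).

(* The sum of 1/(i_1 ... i_k) over the k-tuples of sum N with entries coprime to p. *)
Definition recip_sum (p k N : nat) : rat := (recip_poly p N.+1 ^+ k)`_N.

Lemma recip_poly_coef0 p n : (recip_poly p n)`_0 = 0.
Proof. by rewrite coef_poly invr0 !if_same. Qed.

Lemma coef_recip_polyX p k n N : (N < n)%N -> (recip_poly p n ^+ k)`_N = recip_sum p k N.
Proof.
move=> Nn; apply: (@coef_expr_trunc _ _ _ N) => // j jN.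
by rewrite !coef_poly ltnS jN (leq_ltn_trans jN).
Qed.

Lemma recip_sum_lt p k N : (N < k)%N -> recip_sum p k N = 0.
Proof. exact/coef_expr_lt/recip_poly_coef0. Qed.

Lemma recip_sum0 p N : recip_sum p 0 N = (N == 0%N)%:R.
Proof. by rewrite /recip_sum expr0 coef1. Qed.

Lemma recip_sum_id p N : recip_sum p 1 N = if coprime N p then N%:R^-1 else 0.
Proof. by rewrite /recip_sum expr1 coef_poly ltnSn. Qed.

Lemma recips1E n : recips 1 n = [seq i%:R^-1 | i <- index_iota 1 n].
Proof.
rewrite /recips (eq_filter (a2 := predT)) ?filter_predT // => i.
exact: coprimen1.
Qed.

Lemma elem_sym_recips1 N k : elem_sym (recips 1 N.+1) k.+1
  = \sum_(i < N) i.+1%:R^-1 * elem_sym (recips 1 i.+1) k.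
Proof.
elim: N => [|N IHN]; first by rewrite recips1E big_ord0 elem_symS_nil.
have recips1_rcons : recips 1 N.+2 = rcons (recips 1 N.+1) N.+1%:R^-1.
  rewrite !recips1E /index_iota !subSS !subn0 -[X in iota 1 X]addn1 iotaD add1n.
  by rewrite cats1 map_rcons.
rewrite big_ord_recr /= -IHN -elem_symS_cons recips1_rcons; apply: perm_elem_sym.
by rewrite perm_rcons.
Qed.

(* Differentiate the (k + 1)-st power of the series of -log(1 - x). *)
Lemma recip_sum1 k N : (0 < N)%N ->
  recip_sum 1 k.+1 N = k.+1`!%:R / N%:R * elem_sym (recips 1 N) k.
Proof.
case: N => // N _; elim: k N => [|k IHk] N.
  by rewrite recip_sum_id coprimen1 elem_sym0 div1r mulr1.
have deriv_recip : N.+1%:R * recip_sum 1 k.+2 N.+1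
    = k.+2%:R * \sum_(j < N.+1) recip_sum 1 k.+1 j.
  rewrite mulr_natl -coef_deriv deriv_exp [_^`() * _]mulrC coefMn coefM -[LHS]mulr_natl.
  congr (_ * _); apply: eq_bigr => j _; have jN := ltn_ord j.
  rewrite coef_recip_polyX ?coef_deriv ?coef_poly ?coprimen1; last by lia.
  rewrite (_ : (N - j).+1 < N.+2)%N; last by lia.
  by rewrite -[_^-1 *+ _]mulr_natr mulVf ?pnatr_eq0 // mulr1.
apply: (mulfI (_ : N.+1%:R != 0)); first by rewrite pnatr_eq0.
rewrite deriv_recip mulrA mulrCA divff ?pnatr_eq0 // mulr1 elem_sym_recips1.
rewrite factS natrM -mulrA big_ord_recl recip_sum_lt // add0r !mulr_sumr.
by apply: eq_bigr => j _; rewrite lift0 IHk; ring.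
Qed.

(** * Congruences modulo powers of p *)

Definition pint (p : nat) : {pred rat} := fun x => coprime `|denq x|%N p.

Lemma pintP (p : nat) (x : rat) :
  reflect (exists2 d : nat, coprime d p & x * d%:R \is a Num.int) (x \in pint p).
Proof.
apply: (iffP idP) => [x_p | [d d_p /intrP[a xdE]]].
  exists `|denq x|%N => //.
  have -> : (`|denq x|%N%:R : rat) = (denq x)%:~R.
    by rewrite pmulrn abszE gtr0_norm ?denq_gt0.
  rewrite mulrC -{2}[x]divq_num_den mulrCA divff ?intr_eq0 ?denq_eq0 //.
  by rewrite mulr1 rpred_int.
rewrite unfold_in; apply: coprime_dvdl d_p.
have numdE : numq x * d%:Z = a * denq x.
  apply: (@intr_inj rat); rewrite !intrM -xdE -{2}[x]divq_num_den pmulrn.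
  by rewrite mulrAC divfK ?intr_eq0 ?denq_eq0.
have : (denq x %| numq x * d%:Z)%Z by rewrite numdE dvdz_mull.
by rewrite Gauss_dvdzr // coprimez_sym /coprimez; apply: coprime_num_den.
Qed.

Fact pint_subring_closed p : subring_closed (pint p).
Proof.
split=> [|x y /pintP[d d_p dx] /pintP[e e_p ey]|x y /pintP[d d_p dx] /pintP[e e_p ey]].
- by apply/pintP; exists 1%N; rewrite ?coprime1n // mulr1.
- apply/pintP; exists (d * e)%N; first by rewrite coprimeMl d_p.
  have -> : (x - y) * (d * e)%:R = x * d%:R * e%:R - y * e%:R * d%:R.
    by rewrite natrM; ring.
  by rewrite rpredB // rpredM // rpred_nat.
- apply/pintP; exists (d * e)%N; first by rewrite coprimeMl d_p.
  have -> : x * y * (d * e)%:R = x * d%:R * (y * e%:R) by rewrite natrM; ring.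
  by rewrite rpredM.
Qed.

HB.instance Definition _ p :=
  GRing.isSubringClosed.Build rat (pint p) (pint_subring_closed p).

Definition pdvd (p s : nat) : {pred rat} := fun x => x / (p ^ s)%:R \in pint p.

Lemma pdvdE p s x : (x \in pdvd p s) = (x / (p ^ s)%:R \in pint p).
Proof. by []. Qed.

Lemma eqmodpqE p s x y : eqmodpq p s x y = (x - y \in pdvd p s).
Proof. by []. Qed.

Fact pdvd_zmod_closed p s : zmod_closed (pdvd p s).
Proof.
split=> [|x y]; rewrite !pdvdE ?mul0r ?rpred0 // mulrBl.
exact: rpredB.
Qed.

HB.instance Definition _ p s :=
  GRing.isZmodClosed.Build rat (pdvd p s) (pdvd_zmod_closed p s).

Section PrimeModulus.

Variable p : nat.
Hypothesis p_pr : prime p.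
Implicit Types (i j k m n s t : nat) (x y : rat).

Lemma pdvd0 x : (x \in pdvd p 0) = (x \in pint p).
Proof. by rewrite pdvdE expn0 divr1. Qed.

Lemma expn_prime_neq0 s : (p ^ s)%:R != 0 :> rat.
Proof. by rewrite pnatr_eq0 expn_eq0 negb_and -lt0n prime_gt0. Qed.

Lemma pdvdP s x :
  reflect (exists2 y, y \in pint p & x = (p ^ s)%:R * y) (x \in pdvd p s).
Proof.
apply: (iffP idP) => [px | [y py ->]].
  by exists (x / (p ^ s)%:R); rewrite ?px // mulrC divfK ?expn_prime_neq0.
by rewrite pdvdE mulrC mulKf ?expn_prime_neq0.
Qed.

Lemma pdvdM s t x y : x \in pdvd p s -> y \in pdvd p t -> x * y \in pdvd p (s + t).
Proof.
move=> /pdvdP[a pa ->] /pdvdP[b pb ->]; apply/pdvdP; exists (a * b).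
  by rewrite rpredM.
by rewrite expnD natrM; ring.
Qed.

Lemma pdvdMl s x y : x \in pint p -> y \in pdvd p s -> x * y \in pdvd p s.
Proof. by move=> px py; rewrite -[s]add0n pdvdM ?pdvd0. Qed.

Lemma pdvdMr s x y : x \in pdvd p s -> y \in pint p -> x * y \in pdvd p s.
Proof. by move=> px py; rewrite mulrC pdvdMl. Qed.

Lemma pdvdMnl s n x : x \in pdvd p s -> n%:R * x \in pdvd p s.
Proof. by apply: pdvdMl; rewrite rpred_nat. Qed.

Lemma pdvdW s t x : (s <= t)%N -> x \in pdvd p t -> x \in pdvd p s.
Proof.
move=> st /pdvdP[y py ->]; apply/pdvdP; exists ((p ^ (t - s))%:R * y).
  by rewrite rpredM ?rpred_nat.
by rewrite mulrA -natrM -expnD subnKC.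
Qed.

Lemma pdvd_pint s x : x \in pdvd p s -> x \in pint p.
Proof. by rewrite -pdvd0; apply: pdvdW. Qed.

Lemma pdvd_eqmodpq s t x y : (s <= t)%N -> eqmodpq p t x y ->
  (x \in pdvd p s) = (y \in pdvd p s).
Proof. by move=> st /(pdvdW st) xy; rewrite -[x](subrK y) rpredDl. Qed.

Lemma pdvd_divX s t x : (x / (p ^ t)%:R \in pdvd p s) = (x \in pdvd p (s + t)).
Proof. by rewrite !pdvdE expnD natrM invfM mulrAC mulrA. Qed.

Lemma pdvd_eqmod s m n : m = n %[mod p ^ s] -> m%:R - n%:R \in pdvd p s.
Proof.
move=> mn; apply/pdvdP; exists ((m %/ p ^ s)%:R - (n %/ p ^ s)%:R).
  by rewrite rpredB ?rpred_nat.
by rewrite {1}(divn_eq m (p ^ s)) {1}(divn_eq n (p ^ s)) mn !natrD !natrM; ring.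
Qed.

Lemma pdvd_nat s n : (p ^ s %| n)%N -> n%:R \in pdvd p s.
Proof. by rewrite -[n%:R]subr0 => /eqP n0; rewrite (@pdvd_eqmod _ _ 0) // mod0n. Qed.

Lemma pdvd_prime : p%:R \in pdvd p 1.
Proof. by rewrite pdvd_nat. Qed.

Lemma pdvd_mul_prime m : (m * p)%:R \in pdvd p 1.
Proof. by rewrite pdvd_nat ?dvdn_mull. Qed.

Lemma coprime_prime_gt0 i : coprime i p -> (0 < i)%N.
Proof. by case: i => // /eqP; rewrite gcd0n => p1; move: p_pr; rewrite p1. Qed.

Lemma natr_coprime_neq0 i : coprime i p -> i%:R != 0 :> rat.
Proof. by move=> /coprime_prime_gt0 i_gt0; rewrite pnatr_eq0 -lt0n. Qed.

Lemma coprime_small i : (0 < i < p)%N -> coprime i p.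
Proof.
case/andP=> i_gt0 ip; rewrite coprime_sym prime_coprime //.
by apply: contraTN ip => /(dvdn_leq i_gt0); rewrite -leqNgt.
Qed.

Lemma coprime_eqmod i j : i = j %[mod p] -> coprime i p = coprime j p.
Proof. by move=> ij; rewrite -coprime_modl ij coprime_modl. Qed.

Lemma coprime_subl n i : (p %| n)%N -> (i <= n)%N -> coprime (n - i) p = coprime i p.
Proof. by move=> pn i_n; rewrite !(coprime_sym _ p) !prime_coprime // dvdn_subr. Qed.

Lemma pint_invn i : coprime i p -> i%:R^-1 \in pint p.
Proof.
by move=> i_p; apply/pintP; exists i; rewrite ?mulVf ?natr_coprime_neq0 ?rpred1.
Qed.

Lemma pdvd_cancel i s x : coprime i p -> i%:R * x \in pdvd p s -> x \in pdvd p s.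
Proof.
by move=> i_p px; rewrite -[x](mulKf (natr_coprime_neq0 i_p)) pdvdMl ?pint_invn.
Qed.

Lemma pdvd_subX s n x y : x \in pint p -> y \in pint p ->
  x - y \in pdvd p s -> x ^+ n - y ^+ n \in pdvd p s.
Proof.
move=> px py pxy; rewrite subrXX pdvdMr // rpred_sum // => i _.
by rewrite rpredM ?rpredX.
Qed.

Lemma pdvd_subXp x y : x \in pint p -> y \in pint p ->
  x - y \in pdvd p 1 -> x ^+ p - y ^+ p \in pdvd p 2.
Proof.
move=> px py pxy; have [z pz expE] := exprD_order2 p py (rpredB px py).
have -> : x ^+ p - y ^+ p = p%:R * (y ^+ p.-1 * (x - y)) + (x - y) * (x - y) * z.
  by rewrite (addrC y) subrK in expE; rewrite expE -mulr_natl; ring.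
apply: rpredD; last by rewrite pdvdMr ?(@pdvdM 1 1).
by rewrite (@pdvdM 1 1) ?pdvd_prime ?pdvdMl ?rpredX.
Qed.

Lemma recip_eqmod i j : i = j %[mod p] -> coprime i p ->
  i%:R^-1 - j%:R^-1 \in pdvd p 1.
Proof.
move=> ij i_p; have j_p : coprime j p by rewrite -(coprime_eqmod ij).
have -> : i%:R^-1 - j%:R^-1 = (j%:R - i%:R) * (i%:R^-1 * j%:R^-1) :> rat.
  by field; rewrite !natr_coprime_neq0.
by rewrite pdvdMr ?pdvd_eqmod ?expn1 ?rpredM ?pint_invn.
Qed.

Lemma recip_shift s n i k : (p ^ s %| n)%N -> coprime i p -> coprime (n + i) p ->
  eqmodpq p (s + s) ((n + i)%:R^-1 ^+ k)
    (i%:R^-1 ^+ k - k%:R * n%:R * i%:R^-1 ^+ k.+1).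
Proof.
rewrite eqmodpqE => /pdvd_nat pn i_p ni_p.
have pu := pint_invn i_p; have pv := pint_invn ni_p.
set u := i%:R^-1 in pu *; set v := (n + i)%:R^-1 in pv *.
pose d : rat := - (n%:R * (u * v)).
have vE : v = u + d.
  rewrite /d /v /u; have i0 := natr_coprime_neq0 i_p.
  by have := natr_coprime_neq0 ni_p; rewrite natrD => ni0; field; rewrite ni0.
have pd : d \in pdvd p s by rewrite rpredN pdvdMr ?rpredM.
have [z pz expE] := exprD_order2 k pu (pdvd_pint pd).
case: k expE => [|k] expE; first by rewrite !mul0r subr0 subrr rpred0.
have -> : v ^+ k.+1 - (u ^+ k.+1 - k.+1%:R * n%:R * u ^+ k.+2)
    = d * d * z - k.+1%:R * (n%:R * d * u ^+ k.+1).
  by rewrite vE expE -mulr_natl !exprS {1}/d vE; ring.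
apply: rpredB; first by rewrite pdvdMr ?pdvdM.
by rewrite pdvdMnl // pdvdMr ?pdvdM ?rpredX.
Qed.

(** * Bernoulli numbers and power sums *)

Lemma pdvd_binomial_recurrence s (d : nat -> rat) :
  (forall n, (n.+1 < p)%N ->
     \sum_(i < n.+1) 'C(n.+1, i)%:R * d i \in pdvd p s) ->
  forall n, (n.+1 < p)%N -> d n \in pdvd p s.
Proof.
move=> sum_d; elim/ltn_ind => n IHn np; have := sum_d n np.
rewrite big_ord_recr /= binSn rpredDl.
  by apply: pdvd_cancel; rewrite coprime_small.
by apply: rpred_sum => i _; rewrite pdvdMnl // IHn //; have := ltn_ord i; lia.
Qed.

Lemma bernoulli_pint n : (n.+1 < p)%N -> bernoulli n \in pint p.
Proof.
move=> np; rewrite -pdvd0; move: n np; apply: pdvd_binomial_recurrence => n _.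
by rewrite bernoulliE pdvd0 rpred_nat.
Qed.

Lemma sum_binomial_powers m n :
  \sum_(j < n.+1) 'C(n.+1, j)%:R * \sum_(i < m) i%:R ^+ j = m%:R ^+ n.+1 :> rat.
Proof.
under eq_bigr do rewrite mulr_sumr; rewrite exchange_big /=.
elim: m => [|m IHm]; first by rewrite big_ord0 expr0n.
rewrite big_ord_recr IHm /= -[in RHS]nat1r exprDn [in RHS]big_ord_recr /=.
rewrite subnn mul1r binn addrC.
congr (_ + _); apply: eq_bigr => j _.
by rewrite expr1n mul1r mulr_natl.
Qed.

Lemma sum_expn_bernoulli s m n : (p ^ s %| m)%N -> (n.+1 < p)%N ->
  eqmodpq p (s + s) (\sum_(i < m) i%:R ^+ n) (m%:R * bernoulli n).
Proof.
rewrite eqmodpqE => /pdvd_nat pm; move: n; apply: pdvd_binomial_recurrence => n _.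
under eq_bigr do rewrite mulrBr mulrCA.
rewrite sumrB sum_binomial_powers -mulr_sumr bernoulliE.
case: n => [|n]; first by rewrite mulr1 subrr rpred0.
rewrite mulr0 subr0 !exprS mulrA pdvdMr ?pdvdM ?rpredX //.
exact: pdvd_pint pm.
Qed.

(** * Power sums of reciprocals *)

Lemma power_sum_recips n k :
  power_sum (recips p n) k = \sum_(1 <= i < n | coprime i p) i%:R^-1 ^+ k.
Proof. by rewrite /power_sum /recips big_map big_filter. Qed.

Lemma power_sum_recips_ord n k :
  power_sum (recips p n) k = \sum_(i < n | coprime i p) i%:R^-1 ^+ k.
Proof.
rewrite power_sum_recips -(big_mkord (coprime^~ p) (fun i => i%:R^-1 ^+ k)).
case: n => [|n]; first by rewrite !big_geq.
rewrite [RHS]big_ltn_cond //; case: ifP => // /coprime_prime_gt0.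
by rewrite ltnn.
Qed.

Lemma recips_pint n : {in recips p n, forall x, x \in pint p}.
Proof. by move=> x /mapP[i]; rewrite mem_filter => /andP[i_p _] ->; apply: pint_invn. Qed.

Lemma power_sum_pint (t : seq rat) k :
  {in t, forall x, x \in pint p} -> power_sum t k \in pint p.
Proof.
by move=> pt; rewrite /power_sum big_seq rpred_sum // => x /pt px; apply: rpredX.
Qed.

Lemma pdvd_sum_coprime s n (F : nat -> rat) :
  (forall i, (0 < i < n)%N -> coprime i p -> F i \in pdvd p s) ->
  \sum_(1 <= i < n | coprime i p) F i \in pdvd p s.
Proof. by move=> pF; rewrite big_nat_cond rpred_sum // => i /andP[]; apply: pF. Qed.

Lemma power_sum_recips_rev n k : (p %| n)%N ->
  power_sum (recips p n) k = \sum_(1 <= i < n | coprime i p) (n - i)%:R^-1 ^+ k.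
Proof.
move=> pn; rewrite power_sum_recips big_nat_rev add1n big_nat_cond [RHS]big_nat_cond.
apply: eq_big => i; rewrite subSS //.
by case: (boolP (0 < i < n)%N) => //= /andP[_ /ltnW i_n]; rewrite coprime_subl.
Qed.

Lemma recip_pair_powers s (c u v : rat) k :
  u \in pint p -> v \in pint p -> c \in pdvd p s ->
  u + v = c * (u * v) ->
  u ^+ k.*2 + v ^+ k.*2 - 2 * (- (u * v)) ^+ k \in pdvd p (s + s) /\
  u ^+ k.*2.+1 + v ^+ k.*2.+1 - k.*2.+1%:R * c * (u * v) * (- (u * v)) ^+ k
    \in pdvd p (s + s + s).
Proof.
move=> pu pv pc uv; have pw : u * v \in pint p by rewrite rpredM.
have next j : u ^+ j.+2 + v ^+ j.+2
    = c * (u * v) * (u ^+ j.+1 + v ^+ j.+1) - u * v * (u ^+ j + v ^+ j).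
  by rewrite -uv !exprS; ring.
elim: k => [|k [even_k odd_k]].
  by rewrite !expr0 !expr1 uv !mulr1 mul1r !subrr !rpred0.
set e := (X in X \in _) in even_k; set o := (X in X \in _) in odd_k.
have even_k1 : u ^+ k.+1.*2 + v ^+ k.+1.*2 - 2 * (- (u * v)) ^+ k.+1
    \in pdvd p (s + s).
  have -> : u ^+ k.+1.*2 + v ^+ k.+1.*2 - 2 * (- (u * v)) ^+ k.+1
      = c * (u * v) * (o + c * (k.*2.+1%:R * (u * v) * (- (u * v)) ^+ k)) - u * v * e.
    by rewrite doubleS next /o /e (exprS (- _)); ring.
  apply: rpredB; last exact: pdvdMl.
  apply: pdvdM (pdvdMr pc pw) (rpredD _ _).
    by apply: pdvdW odd_k; rewrite -addnA leq_addr.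
  by rewrite pdvdMr // !rpredM ?rpredX ?rpredN ?rpred_nat.
split=> //.
have -> : u ^+ k.+1.*2.+1 + v ^+ k.+1.*2.+1
    - k.+1.*2.+1%:R * c * (u * v) * (- (u * v)) ^+ k.+1
  = c * (u * v) * (u ^+ k.+1.*2 + v ^+ k.+1.*2 - 2 * (- (u * v)) ^+ k.+1) - u * v * o.
  by rewrite doubleS next /o -!natr1 (exprS (- _)); ring.
apply: rpredB; last exact: pdvdMl.
by rewrite -addnA; apply: pdvdM (pdvdMr pc pw) even_k1.
Qed.

(* Pairing i with n - i, whose reciprocals u and v satisfy u + v = n u v. *)
Lemma power_sum_recips_odd s n k : odd p -> (0 < s)%N -> (p ^ s %| n)%N ->
  2 * power_sum (recips p n) k.*2.+1 + k.*2.+1%:R * n%:R * power_sum (recips p n) k.*2.+2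
    \in pdvd p (s + s + s).
Proof.
move=> p_odd s_gt0 psn; have pn : (p %| n)%N by apply: dvdn_trans psn; apply: dvdn_exp.
apply: (@pdvd_cancel 2); first by rewrite coprime2n.
have double_power_sum j : 2 * power_sum (recips p n) j
    = \sum_(1 <= i < n | coprime i p) (i%:R^-1 ^+ j + (n - i)%:R^-1 ^+ j).
  by rewrite mulr_natl mulr2n {1}power_sum_recips power_sum_recips_rev // -big_split.
rewrite mulrDr (mulrCA 2 (_ * _)) 2!double_power_sum !mulr_sumr -big_split /=.
apply: pdvd_sum_coprime => i /andP[_ /ltnW i_n] i_p.
have ni_p : coprime (n - i) p by rewrite coprime_subl.
have := natr_coprime_neq0 i_p; have := natr_coprime_neq0 ni_p.
have := pint_invn i_p; have := pint_invn ni_p; rewrite natrB //.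
move: (i%:R) (n%:R) (pdvd_nat psn) => a {i_n}n' pn' pv pu nz az.
set u := a^-1 in pu *; set v := (n' - a)^-1 in pv *.
have uv : u + v = n' * (u * v) by rewrite /u /v; field; rewrite nz az.
have [_ odd_k] := recip_pair_powers k pu pv pn' uv.
have [even_k1 _] := recip_pair_powers k.+1 pu pv pn' uv.
set o := (X in X \in _) in odd_k; set e := (X in X \in _) in even_k1.
have -> : 2 * (u ^+ k.*2.+1 + v ^+ k.*2.+1)
    + k.*2.+1%:R * n' * (u ^+ k.*2.+2 + v ^+ k.*2.+2) = 2 * o + k.*2.+1%:R * (n' * e).
  by rewrite /o /e doubleS (exprS (- _)); ring.
by apply: rpredD; rewrite pdvdMnl // -addnA pdvdM.
Qed.

Lemma power_sum_recips_odd_pdvd s n k : odd p -> (0 < s)%N -> (p ^ s %| n)%N ->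
  power_sum (recips p n) k.*2.+1 \in pdvd p s.
Proof.
move=> p_odd s_gt0 psn; apply: (@pdvd_cancel 2); first by rewrite coprime2n.
have := pdvdW (leq_addl (s + s) s) (power_sum_recips_odd k p_odd s_gt0 psn).
rewrite rpredDr // -mulrA pdvdMnl // pdvdMr ?pdvd_nat //.
exact/power_sum_pint/recips_pint.
Qed.

Lemma power_sum_recips_block m k : power_sum (recips p (m.+1 * p)) k
  = power_sum (recips p (m * p)) k + \sum_(i < p | coprime i p) (m * p + i)%:R^-1 ^+ k.
Proof.
rewrite !power_sum_recips_ord mulSnr big_split_ord; congr (_ + _).
by apply: eq_bigl => i; apply: coprime_eqmod; rewrite modnMDl.
Qed.

Lemma power_sum_recips_mul_prime m k : odd p -> ~~ odd k ->
  eqmodpq p 2 (power_sum (recips p (m * p)) k) (m%:R * power_sum (recips p p) k).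
Proof.
rewrite eqmodpqE => p_odd k_even; elim: m => [|m IHm].
  by rewrite mul0n mul0r subr0 power_sum_recips big_geq ?rpred0.
have pP : power_sum (recips p p) k.+1 \in pdvd p 1.
  by rewrite -(even_halfK k_even) power_sum_recips_odd_pdvd.
pose shift i : rat := i%:R^-1 ^+ k - k%:R * (m * p)%:R * i%:R^-1 ^+ k.+1.
have -> : power_sum (recips p (m.+1 * p)) k - m.+1%:R * power_sum (recips p p) k
  = (power_sum (recips p (m * p)) k - m%:R * power_sum (recips p p) k)
    + \sum_(i < p | coprime i p) ((m * p + i)%:R^-1 ^+ k - shift i)
    - k%:R * ((m * p)%:R * power_sum (recips p p) k.+1).
  rewrite power_sum_recips_block sumrB [\sum_(i < p | _) shift i]sumrB -mulr_sumr.
  by rewrite -!power_sum_recips_ord -natr1; ring.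
apply: rpredB; last by rewrite pdvdMnl // (@pdvdM 1 1) ?pdvd_mul_prime.
apply: rpredD => //; apply: rpred_sum => i i_p; rewrite -eqmodpqE.
apply: (@recip_shift 1) => //.
  by rewrite dvdn_mull.
by rewrite (coprime_eqmod (modnMDl _ _ _)).
Qed.

Lemma ex_expn_neq1 k : (0 < k < p.-1)%N ->
  exists2 a, coprime a p & a ^ k != 1 %[mod p].
Proof.
case/andP=> k_gt0 kp; have p_gt0 := prime_gt0 p_pr.
have [/existsP[a /andP[a_p ak]]|] :=
  boolP [exists a : 'I_p, coprime a p && (a ^ k != 1 %[mod p])].
  by exists (a : nat).
rewrite negb_exists => /forallP root_all.
pose rs : seq 'F_p := [seq i%:R | i <- iota 1 p.-1].
suff : (size rs <= k)%N by rewrite size_map size_iota leqNgt kp.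
have mem_iota1 i : i \in iota 1 p.-1 -> (0 < i < p)%N.
  by rewrite mem_iota add1n prednK.
apply: max_unity_roots => //.
  apply/allP=> x /mapP[i /mem_iota1 i_p ->]; apply/unity_rootP.
  have := root_all (Ordinal (proj2 (andP i_p))); rewrite coprime_small //= negbK.
  by move=> /eqP ak; apply/val_inj; rewrite -natrX /= val_Fp_nat // Fp_cast.
rewrite map_inj_in_uniq ?iota_uniq // => i j /mem_iota1/andP[_ ip] /mem_iota1/andP[_ jp].
by move/(congr1 val); rewrite /= !val_Fp_nat // !modn_small.
Qed.

Lemma sum_mul_coprime s a (F : nat -> rat) : coprime a p ->
  (forall i, coprime i p -> F (i %% p)%N - F i \in pdvd p s) ->
  \sum_(i < p | coprime i p) F i - \sum_(i < p | coprime i p) F (a * i)%N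
    \in pdvd p s.
Proof.
move=> a_p pF; pose mul_a (i : 'I_p) := Ordinal (ltn_pmod (a * i) (prime_gt0 p_pr)).
have mul_a_inj : injective mul_a.
  move=> i j /(congr1 val)/= /eqP; wlog ij : i j / (i <= j)%N => [IH|].
    by case: (leqP i j) => [/IH//|/ltnW/IH ji]; rewrite eq_sym => /ji.
  rewrite eq_sym eqn_mod_dvd ?leq_mul2l ?ij ?orbT // -mulnBr.
  rewrite Gauss_dvdr 1?coprime_sym // -eqn_mod_dvd // !modn_small //.
  by move/eqP=> ji; apply: val_inj.
rewrite [X in X - _](reindex_inj mul_a_inj) /=.
under eq_bigl do rewrite coprime_modl coprimeMl a_p /=.
by rewrite -sumrB rpred_sum // => i i_p; rewrite pF // coprimeMl a_p.
Qed.

(* Modulo p^2 the p-th power of i only depends on i modulo p, so replacing i by a i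
   permutes the terms while it divides the sum by a^(k p), which is a^k modulo p. *)
Lemma sum_recips_exp_prime k : (0 < k < p.-1)%N ->
  \sum_(i < p | coprime i p) i%:R^-1 ^+ (k * p) \in pdvd p 2.
Proof.
move=> k_p; have [a a_p ak] := ex_expn_neq1 k_p.
pose F i : rat := i%:R^-1 ^+ (k * p); set S := \sum_(i < p | _) _.
have pF i : coprime i p -> F (i %% p)%N - F i \in pdvd p 2.
  move=> i_p; have im_p : coprime (i %% p) p by rewrite coprime_modl.
  rewrite /F mulnC !exprM pdvd_subX ?rpredX ?pint_invn //.
  by rewrite pdvd_subXp ?pint_invn // recip_eqmod ?modn_mod.
have := sum_mul_coprime a_p pF; rewrite -/S.
have -> : \sum_(i < p | coprime i p) F (a * i)%N = (a ^ (k * p))%:R^-1 * S.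
  rewrite mulr_sumr; apply: eq_bigr => i _.
  by rewrite natrX -exprVn -exprMn -invfM -natrM.
have akp0 : (0 < a ^ (k * p))%N by rewrite expn_gt0 (coprime_prime_gt0 a_p).
have akp_neq0 : (a ^ (k * p))%:R != 0 :> rat by rewrite pnatr_eq0 -lt0n.
move/(pdvdMnl (a ^ (k * p))%N); rewrite mulrBr mulVKf // -[X in _ - X]mul1r -mulrBl.
rewrite -(natrB _ akp0); apply: pdvd_cancel; rewrite coprime_sym prime_coprime //.
by rewrite -eqn_mod_dvd // expnM fermat_little.
Qed.

Lemma fermat_pdvd i : coprime i p -> i%:R ^+ p.-1 - 1 \in pdvd p 1.
Proof.
move=> i_p; apply: (pdvd_cancel i_p); rewrite mulrBr mulr1 -exprS.
by rewrite prednK ?prime_gt0 // -natrX pdvd_eqmod // expn1 fermat_little.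
Qed.

(* With x = i^(p-1), the polynomial k x^(k+1) - (k + 1) x^k + 1 is divisible by
   (x - 1)^2. *)
Lemma recip_exp_mod i k : (k <= p.-1)%N -> coprime i p ->
  eqmodpq p 2 (k.+1%:R * i%:R^-1 ^+ k)
    (k%:R * i%:R ^+ (p.-1 - k) + i%:R^-1 ^+ (k * p)).
Proof.
move=> k_p i_p; have pu := pint_invn i_p; have i0 := natr_coprime_neq0 i_p.
have px := fermat_pdvd i_p; set x := _ ^+ p.-1 in px.
have x0 : x != 0 by rewrite expf_neq0.
have py : x^-1 \in pint p by rewrite -exprVn rpredX.
have -> : i%:R ^+ (p.-1 - k) = x * i%:R^-1 ^+ k :> rat.
  by rewrite exprVn -expfB_cond // (negbTE i0).
have -> : i%:R^-1 ^+ (k * p) = i%:R^-1 ^+ k * x^-1 ^+ k :> rat.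
  by rewrite /x -exprVn -exprM -exprD -mulSn prednK ?prime_gt0 // mulnC.
have [z pz] := exprD_order2 k (rpred1 _) (rpredB py (rpred1 (pint p))).
rewrite addrC subrK eqmodpqE => ->.
set u := i%:R^-1 in pu *.
have -> : k.+1%:R * u ^+ k - (k%:R * (x * u ^+ k)
    + u ^+ k * (1 ^+ k + 1 ^+ k.-1 * (x^-1 - 1) *+ k + (x^-1 - 1) ^+ 2 * z))
  = (x - 1) * (x - 1) * (- (u ^+ k * (k%:R * x^-1 + x^-1 ^+ 2 * z))).
  by rewrite !expr1n -mulr_natl -natr1; field.
rewrite pdvdMr ?(@pdvdM 1 1) // rpredN rpredM ?rpredX // rpredD ?rpredM ?rpredX //.
exact: rpred_nat.
Qed.

Lemma power_sum_recips_bernoulli k : (0 < k < p.-1)%N ->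
  eqmodpq p 2 (k.+1%:R * power_sum (recips p p) k)
    (k%:R * (p%:R * bernoulli (p.-1 - k))).
Proof.
move=> k_p; have := k_p => /andP[k_gt0 kp].
have sum_powers := @sum_expn_bernoulli 1 p (p.-1 - k) (dvdnn _).
rewrite !eqmodpqE in sum_powers *; set T := \sum_(i < p) _ in sum_powers.
have TE : T = \sum_(i < p | coprime i p) i%:R ^+ (p.-1 - k).
  rewrite /T [RHS]big_mkcond; apply: eq_bigr => -[[|i] ip] _ /=.
    by rewrite expr0n subn_eq0 leqNgt kp if_same.
  by rewrite coprime_small.
pose V : rat := \sum_(i < p | coprime i p) i%:R^-1 ^+ (k * p).
pose rest i : rat := k.+1%:R * i%:R^-1 ^+ k
  - (k%:R * i%:R ^+ (p.-1 - k) + i%:R^-1 ^+ (k * p)).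
have -> : k.+1%:R * power_sum (recips p p) k - k%:R * (p%:R * bernoulli (p.-1 - k))
  = \sum_(i < p | coprime i p) rest i + V + k%:R * (T - p%:R * bernoulli (p.-1 - k)).
  rewrite /rest sumrB big_split /= -!mulr_sumr -TE -/V power_sum_recips_ord.
  by ring.
apply: rpredD; last by rewrite pdvdMnl // sum_powers //; lia.
apply: rpredD (sum_recips_exp_prime k_p); apply: rpred_sum => i i_p.
by rewrite -eqmodpqE; apply: recip_exp_mod (ltnW kp) i_p.
Qed.

Lemma elem_sym_pint (t : seq rat) k :
  {in t, forall x, x \in pint p} -> elem_sym t k \in pint p.
Proof.
move=> pt; apply: polyOverP; rewrite /elem_sym big_seq rpred_prod // => x /pt px.
by rewrite rpredD ?rpred1 // polyOverZ ?polyOverX.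
Qed.

Lemma elem_sym_mod_power_sum (t : seq rat) :
  (3 < p)%N -> {in t, forall x, x \in pint p} ->
  power_sum t 1 \in pdvd p 2 -> power_sum t 2 \in pdvd p 1 ->
  eqmodpq p 3 (3 * elem_sym t 3) (power_sum t 3) /\
  eqmodpq p 2 (4 * elem_sym t 4) (- power_sum t 4).
Proof.
move=> p_gt3 pt p1 p2.
have e1E : elem_sym t 1 = power_sum t 1.
  by have := newton_identity t 1; rewrite big_ord1 subnn elem_sym0 !mul1r.
have e2E : 2 * elem_sym t 2 = elem_sym t 1 * power_sum t 1 - power_sum t 2.
  by rewrite newton_identity !big_ord_recr big_ord0 /= !subSS !subn0 elem_sym0; ring.
have e3E : 3 * elem_sym t 3
    = elem_sym t 2 * power_sum t 1 - elem_sym t 1 * power_sum t 2 + power_sum t 3.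
  by rewrite newton_identity !big_ord_recr big_ord0 /= !subSS !subn0 elem_sym0; ring.
have e4E : 4 * elem_sym t 4
    = elem_sym t 3 * power_sum t 1 - elem_sym t 2 * power_sum t 2
      + elem_sym t 1 * power_sum t 3 - power_sum t 4.
  by rewrite newton_identity !big_ord_recr big_ord0 /= !subSS !subn0 elem_sym0; ring.
have e1 : elem_sym t 1 \in pdvd p 2 by rewrite e1E.
have e2 : elem_sym t 2 \in pdvd p 1.
  apply: (@pdvd_cancel 2); first by apply: coprime_small; lia.
  by rewrite e2E rpredB // pdvdMl ?(pdvd_pint e1) // (pdvdW _ p1).
rewrite !eqmodpqE e3E e4E addrK opprK subrK; split.
  by apply: rpredB; [exact: (@pdvdM 1 2) | exact: (@pdvdM 2 1)].
apply: rpredD; last exact/pdvdMr/power_sum_pint.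
by apply: rpredB; [exact/pdvdMl/p1/elem_sym_pint | exact: (@pdvdM 1 1)].
Qed.

(** * Inclusion-exclusion on the multiples of p *)

Lemma perm_recips1_mul m :
  perm_eq (recips 1 (m * p)) ([seq p%:R^-1 * x | x <- recips 1 m] ++ recips p (m * p)).
Proof.
have p_gt0 := prime_gt0 p_pr.
have -> : [seq p%:R^-1 * x | x <- recips 1 m]
    = [seq i%:R^-1 | i <- [seq (p * i)%N | i <- index_iota 1 m]].
  by rewrite recips1E -!map_comp; apply: eq_map => i /=; rewrite natrM invfM.
rewrite recips1E /recips -map_cat perm_map //.
rewrite -(perm_filterC (coprime^~ p) (index_iota 1 (m * p))) perm_catC perm_cat2r.
apply: uniq_perm; rewrite ?filter_uniq ?iota_uniq //.
  by rewrite map_inj_uniq ?iota_uniq // => i j /eqP; rewrite eqn_pmul2l // => /eqP.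
move=> i; rewrite mem_filter mem_index_iota /= coprime_sym prime_coprime // negbK.
apply/andP/mapP=> [[/dvdnP[j ->] /andP[j_gt0 jm]] | [j]].
  exists j; rewrite 1?mulnC // mem_index_iota.
  by move: j_gt0 jm; rewrite muln_gt0 ltn_pmul2r // => /andP[-> _] ->.
rewrite mem_index_iota => /andP[j_gt0 jm] ->; rewrite dvdn_mulr //.
by rewrite mulnC ltn_pmul2r // jm muln_gt0 j_gt0 p_gt0.
Qed.

Lemma recip_poly1_mul m : recip_poly 1 (m * p).+1
  = recip_poly p (m * p).+1 + p%:R^-1 *: (recip_poly 1 m.+1 \Po 'X^p).
Proof.
have p_gt0 := prime_gt0 p_pr; apply/polyP=> i.
rewrite coefD coefZ coef_comp_poly_Xn // !coef_poly !coprimen1 ltnS.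
rewrite coprime_sym prime_coprime //; case: (boolP (p %| i)%N) => [/dvdnP[j ->]|_] /=.
  rewrite mulnK // ltnS leq_pmul2r // if_same add0r.
  by case: ifP; rewrite ?mulr0 // natrM invfM mulrC.
by rewrite mulr0 addr0.
Qed.

Lemma recip_sum_inclusion_exclusion k m : recip_sum p k (m * p)
  = \sum_(i < k.+1) 'C(k, i)%:R * (- p%:R^-1) ^+ i
      * \sum_(j < m.+1) recip_sum 1 (k - i) (j * p) * recip_sum 1 i (m - j).
Proof.
have p_gt0 := prime_gt0 p_pr.
have polyE : recip_poly p (m * p).+1
    = recip_poly 1 (m * p).+1 + (- p%:R^-1) *: (recip_poly 1 m.+1 \Po 'X^p).
  by rewrite recip_poly1_mul scaleNr addrK.
rewrite {1}/recip_sum polyE exprDn coef_sum; apply: eq_bigr => i _.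
rewrite coefMn exprZn -scalerAr coefZ -rmorphXn coef_mul_comp_Xn // -[LHS]mulr_natl mulrA.
congr (_ * _); apply: eq_bigr => j _; have jm := ltn_ord j.
by rewrite !coef_recip_polyX ?ltnS ?leq_subr // leq_pmul2r.
Qed.

Lemma recip_sum_mul_prime k m : (m < k)%N -> recip_sum p k (m * p)
  = \sum_(i < m) 'C(k, i)%:R * (- p%:R^-1) ^+ i
      * \sum_(j < m.+1) recip_sum 1 (k - i) (j * p) * recip_sum 1 i (m - j).
Proof.
move=> mk; rewrite recip_sum_inclusion_exclusion; apply/esym.
pose term i : rat := 'C(k, i)%:R * (- p%:R^-1) ^+ i
  * \sum_(j < m.+1) recip_sum 1 (k - i) (j * p) * recip_sum 1 i (m - j).
apply: (@sum_ord_widen _ _ _ term); first exact/ltnW/ltnW.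
move=> i /andP[mi ik]; rewrite /term big1 ?mulr0 // => -[[|j] jm] _ /=; last first.
  by rewrite [X in _ * X]recip_sum_lt ?mulr0 //; lia.
have [ik'|ki] := ltnP i k; first by rewrite recip_sum_lt ?mul0r ?subn_gt0.
by rewrite [X in _ * X]recip_sum_lt ?mulr0 //; lia.
Qed.

Lemma recip_sum_prime k : (1 < k)%N -> recip_sum p k p = recip_sum 1 k p.
Proof.
move=> k_gt1; rewrite -{2}[p]mul1n recip_sum_mul_prime //.
rewrite big_ord1 !big_ord_recr big_ord0 /= !recip_sum0 bin0 subn0 mul1n.
by rewrite mulr0 !add0r !mulr1 mul1r.
Qed.

Lemma recip_sum_double_prime k : (2 < k)%N -> recip_sum p k (2 * p)
  = recip_sum 1 k (2 * p) - k%:R / p%:R * recip_sum 1 k.-1 p.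
Proof.
move=> k_gt2; rewrite recip_sum_mul_prime // !big_ord_recr !big_ord0 /=.
rewrite !recip_sum0 !recip_sum_id /= bin0 bin1 subn0 subn1 mul1n invr0.
rewrite [recip_sum 1 k.-1 (0 * p)]recip_sum_lt; last by lia.
by rewrite invr1; ring.
Qed.

(** * Blocks of length p^r *)

Lemma polyOver_pdvdM s t (P Q : {poly rat}) :
  P \is a polyOver (pdvd p s) -> Q \is a polyOver (pdvd p t) ->
  P * Q \is a polyOver (pdvd p (s + t)).
Proof.
move=> /polyOverP pP /polyOverP pQ; apply/polyOverP=> i.
by rewrite coefM rpred_sum // => j _; rewrite pdvdM.
Qed.

Lemma polyOver_pdvdMl s (P Q : {poly rat}) :
  P \is a polyOver (pint p) -> Q \is a polyOver (pdvd p s) ->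
  P * Q \is a polyOver (pdvd p s).
Proof.
move=> /polyOverP pP; apply: (@polyOver_pdvdM 0); apply/polyOverP=> i.
by rewrite pdvd0.
Qed.

Lemma polyOver_pdvdZ s (c : rat) (P : {poly rat}) :
  c \in pdvd p s -> P \is a polyOver (pint p) -> c *: P \is a polyOver (pdvd p s).
Proof. by move=> pc /polyOverP pP; apply/polyOverP=> i; rewrite coefZ pdvdMr. Qed.

Lemma polyOver_pdvd_subX s k (P Q : {poly rat}) :
  P \is a polyOver (pint p) -> Q \is a polyOver (pint p) ->
  P - Q \is a polyOver (pdvd p s) -> P ^+ k - Q ^+ k \is a polyOver (pdvd p s).
Proof.
move=> pP pQ pPQ; rewrite subrXX mulrC polyOver_pdvdMl // rpred_sum // => i _.
by rewrite rpredM ?rpredX.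
Qed.

Lemma ffact_addn_mod s n a b : (p ^ s %| n)%N ->
  eqmodpq p (s + s) ((n + a) ^_ (a + b).+1)%:R ((-1) ^+ b * a`!%:R * b`!%:R * n%:R).
Proof.
rewrite eqmodpqE => /pdvd_nat pn; have pnn := pdvdM pn pn.
elim: a => [|a IHa]; last first.
  rewrite addnS addSn ffactSS natrM factS natrM -nat1r natrD.
  set X := (_ ^_ _)%:R in IHa *; set Y := _ * n%:R in IHa.
  have -> : (1 + (n%:R + a%:R)) * X - (-1) ^+ b * (a.+1%:R * a`!%:R) * b`!%:R * n%:R
    = (1 + (n%:R + a%:R)) * (X - Y) + n%:R * n%:R * ((-1) ^+ b * a`!%:R * b`!%:R).
    by rewrite /Y -natr1; ring.
  apply: rpredD; first by apply: pdvdMl IHa; rewrite !rpredD ?rpred1 ?rpred_nat.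
  by apply: pdvdMr pnn _; rewrite !rpredM ?rpredX ?rpredN ?rpred1 ?rpred_nat.
rewrite addn0 add0n fact0 mulr1; elim: b => [|b IHb].
  by rewrite ffactn1 fact0 !mul1r subrr rpred0.
have -> : (n ^_ b.+2)%:R = (n ^_ b.+1)%:R * (n%:R - b.+1%:R) :> rat.
  have [bn|nb] := leqP b.+1 n; first by rewrite ffactnSr natrM natrB.
  by rewrite !ffact_small ?mul0r // ltnW.
set X := (_ ^_ _)%:R in IHb *; set Y := _ * n%:R in IHb.
have -> : X * (n%:R - b.+1%:R) - (-1) ^+ b.+1 * b.+1`!%:R * n%:R
  = (n%:R - b.+1%:R) * (X - Y) + n%:R * n%:R * ((-1) ^+ b * b`!%:R).
  by rewrite /Y factS natrM exprS; ring.
apply: rpredD; first by apply: pdvdMl IHb; rewrite rpredB ?rpred_nat.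
by apply: pdvdMr pnn _; rewrite rpredM ?rpredX ?rpredN ?rpred1 ?rpred_nat.
Qed.

Lemma fact_coprime_prime k : (k < p)%N -> coprime k`! p.
Proof.
elim: k => [|k IHk] kp; first exact: coprime1n.
by rewrite factS coprimeMl coprime_small ?IHk // ltnW.
Qed.

Lemma bin_addn_pdvd s n a k : (p ^ s %| n)%N -> (a < k < p)%N ->
  'C(n + a, k)%:R \in pdvd p s.
Proof.
move=> psn /andP[ak kp]; apply: (pdvd_cancel (fact_coprime_prime kp)).
rewrite mulrC -natrM bin_ffact -(subnKC ak) addSn.
have := ffact_addn_mod a (k - a.+1) psn.
move/(pdvd_eqmodpq (leq_addr s s)) => ->; rewrite pdvdMl ?pdvd_nat //.
by rewrite !rpredM ?rpredX ?rpredN ?rpred1 ?rpred_nat.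
Qed.

Section Blocks.

Variable r : nat.
Hypothesis r_gt0 : (0 < r)%N.

Let q := (p ^ r)%N.

Let q_gt0 : (0 < q)%N.
Proof. by rewrite expn_gt0 prime_gt0. Qed.

Let p_dvd_q : (p %| q)%N.
Proof. exact: dvdn_exp. Qed.

Definition block_sum k c := (recip_poly p q ^+ k)`_(c * q).

Definition recip_sq_poly : {poly rat} :=
  \poly_(i < q) (if coprime i p then i%:R^-1 ^+ 2 else 0).

Definition sq_block_sum k c := (recip_poly p q ^+ k * recip_sq_poly)`_(c * q).

Lemma recip_poly_pint n : recip_poly p n \is a polyOver (pint p).
Proof. by apply: polyOver_poly => i _; case: ifP => [/pint_invn|] //; rewrite rpred0. Qed.

Lemma recip_sq_poly_pint : recip_sq_poly \is a polyOver (pint p).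
Proof.
by apply: polyOver_poly => i _; case: ifP => [/pint_invn pi|_]; rewrite ?rpred0 ?rpredX.
Qed.

Lemma geom_poly_pint n : geom_poly rat n \is a polyOver (pint p).
Proof. by apply: polyOver_poly => i _; apply: rpred1. Qed.

Lemma coprime_modq i : coprime (i %% q) p = coprime i p.
Proof. by apply: coprime_eqmod; rewrite modn_dvdm. Qed.

Definition main_part n : {poly rat} := recip_poly p q * (geom_poly rat n \Po 'X^q).

Definition linear_part n : {poly rat} :=
  recip_sq_poly * (('X * (geom_poly rat n)^`()) \Po 'X^q).

Lemma main_part_pint n : main_part n \is a polyOver (pint p).
Proof.
by rewrite rpredM ?recip_poly_pint // polyOver_comp ?geom_poly_pint ?polyOverXn.
Qed.

Lemma linear_part_pint n : linear_part n \is a polyOver (pint p).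
Proof.
rewrite rpredM ?recip_sq_poly_pint // polyOver_comp ?polyOverXn //.
by rewrite rpredM ?polyOverX ?polyOver_deriv ?geom_poly_pint.
Qed.

(* The first-order expansion 1/(a + q b) = 1/a - q b/a^2, summed over the residues a and
   the quotients b of the exponents modulo q. *)
Lemma recip_poly_expand n :
  recip_poly p (n * q) - (main_part n - q%:R *: linear_part n)
    \is a polyOver (pdvd p (r + r)).
Proof.
apply/polyOverP=> i; rewrite !(coefB, coefZ).
rewrite !coef_mul_comp_Xn_small ?size_poly // coefXM coef_deriv !coef_poly.
rewrite ltn_mod q_gt0 coprime_modq -ltn_divLR //.
have -> : (if (i %/ q == 0)%N then 0 else (if ((i %/ q).-1.+1 < n)%N then 1 else 0)
    *+ (i %/ q).-1.+1) = if (i %/ q < n)%N then (i %/ q)%:R else 0 :> rat.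
  by case: (i %/ q)%N => [|b] /=; case: ifP => //; rewrite mul0rn.
case: (boolP (coprime i p)) => i_p; last first.
  by rewrite !if_same !(mul0r, mulr0) !subr0 rpred0.
case: ifP => _; last by rewrite !mulr0 !subr0 rpred0.
have := @recip_shift r (i %/ q * q) (i %% q) 1.
rewrite eqmodpqE -divn_eq coprime_modq !expr1 mul1r mulr1 natrM.
by move=> /(_ (dvdn_mull _ (dvdnn _)) i_p i_p); congr (is_true (in_mem _ _)); ring.
Qed.

Lemma recip_polyX_expand k n :
  recip_poly p (n * q) ^+ k.+1
    - (main_part n ^+ k.+1 - q%:R *: (main_part n ^+ k * linear_part n *+ k.+1))
  \is a polyOver (pdvd p (r + r)).
Proof.
set f := recip_poly _ _; set U := main_part n; set V := linear_part n.
pose W := q%:R *: V; pose D := f - (U - W) - W; have fE : f = U + D by rewrite /D; ring.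
have pf : f - (U - W) \is a polyOver (pdvd p (r + r)) := recip_poly_expand n.
have pW : W \is a polyOver (pdvd p r).
  by rewrite polyOver_pdvdZ ?pdvd_nat ?linear_part_pint.
have pD : D \is a polyOver (pdvd p r).
  by apply: rpredB pW; apply: polyOverS pf => x; apply/pdvdW/leq_addr.
have [|z pz fX] := exprD_order2 k.+1 (main_part_pint n) (_ : D \is a polyOver (pint p)).
  by apply: polyOverS pD => x; apply: pdvd_pint.
have -> : f ^+ k.+1 - (U ^+ k.+1 - q%:R *: (U ^+ k * V *+ k.+1))
    = U ^+ k * (f - (U - W)) *+ k.+1 + z * (D * D).
  by rewrite {1}fE fX /= -scalerMnr scalerAr -/W -/U /D; ring.
rewrite rpredD ?rpredMn //; last exact/polyOver_pdvdMl/polyOver_pdvdM.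
by apply: polyOver_pdvdMl pf; rewrite rpredX ?main_part_pint.
Qed.

Lemma coef_main_partX k n : (main_part n.+1 ^+ k.+1)`_(n * q)
  = \sum_(c < n.+1) block_sum k.+1 c * 'C(n - c + k, k)%:R.
Proof.
rewrite /main_part exprMn -rmorphXn coef_mul_comp_Xn //; apply: eq_bigr => c _.
by rewrite coef_geom_polyX //; lia.
Qed.

Lemma coef_linear_partX k n : (main_part n.+1 ^+ k * linear_part n.+1 *+ k.+1)`_(n * q)
  = \sum_(c < n.+1) sq_block_sum k c * ((n - c)%:R * 'C(n - c + k, k)%:R).
Proof.
have -> : main_part n.+1 ^+ k * linear_part n.+1 *+ k.+1 = recip_poly p q ^+ k
    * recip_sq_poly * (('X * (geom_poly rat n.+1 ^+ k.+1)^`()) \Po 'X^q).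
  rewrite deriv_exp !rmorphM /= rmorphMn /= !rmorphM rmorphXn.
  by rewrite /main_part /linear_part exprMn rmorphM /= -!mulrnAr; ring.
rewrite coef_mul_comp_Xn //; apply: eq_bigr => c _; congr (_ * _).
rewrite coefXM; case: eqP => [->|/eqP nc]; first by rewrite mul0r.
by rewrite coef_deriv prednK ?lt0n // coef_geom_polyX ?mulr_natl //; lia.
Qed.

Lemma recip_sum_expand k n :
  eqmodpq p (r + r) (recip_sum p k.+1 (n * q))
    (\sum_(c < n.+1) block_sum k.+1 c * 'C(n - c + k, k)%:R
     - q%:R * \sum_(c < n.+1) sq_block_sum k c * ((n - c)%:R * 'C(n - c + k, k)%:R)).
Proof.
rewrite eqmodpqE -coef_main_partX -coef_linear_partX -coefZ.
rewrite -(coef_recip_polyX p k.+1 (n := n.+1 * q)) ?ltn_pmul2r // -!coefB.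
exact: (polyOverP (recip_polyX_expand k n.+1)).
Qed.

Lemma block_sum0 k : block_sum k.+1 0 = 0.
Proof. by rewrite /block_sum mul0n coef_expr_lt ?recip_poly_coef0. Qed.

Lemma size_recip_polyX k : (size (recip_poly p q ^+ k) <= (k * q.-1).+1)%N.
Proof.
apply: leq_trans (size_poly_exp_leq _ _) _; rewrite ltnS mulnC leq_mul2l.
by rewrite -!subn1 leq_sub2r ?orbT ?size_poly.
Qed.

Lemma block_sum_gt k c : (k < c)%N -> block_sum k.+1 c = 0.
Proof.
move=> kc; rewrite /block_sum nth_default //.
by apply: leq_trans (size_recip_polyX _) _; move: q_gt0 => ?; nia.
Qed.

Lemma sq_block_sum0 k : sq_block_sum k 0 = 0.
Proof.
by rewrite /sq_block_sum mul0n coef0M !coef_poly q_gt0 invr0 expr0n if_same mulr0.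
Qed.

Lemma sq_block_sum_gt k c : (k < c)%N -> sq_block_sum k c = 0.
Proof.
move=> kc; rewrite /sq_block_sum nth_default //; apply: leq_trans (size_polyMleq _ _) _.
have := size_recip_polyX k; have : (size recip_sq_poly <= q)%N by apply: size_poly.
by move: (size _) (size _) q_gt0 => ? ?; nia.
Qed.

Lemma sq_block_sum_pint k c : sq_block_sum k c \in pint p.
Proof.
by apply: polyOverP; rewrite rpredM ?rpredX ?recip_poly_pint ?recip_sq_poly_pint.
Qed.

Lemma sum_block_sum k n : \sum_(c < n.+1) block_sum k.+1 c * 'C(n - c + k, k)%:R
  = \sum_(c < k.+1) block_sum k.+1 c * 'C(n + k - c, k)%:R.
Proof.
pose F c := block_sum k.+1 c * 'C(n + k - c, k)%:R.
transitivity (\sum_(c < n.+1) F c).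
  by apply: eq_bigr => c _; rewrite /F addnBAC // -ltnS.
rewrite (@sum_ord_widen _ _ (n + k).+1 F) ?ltnS ?leq_addr //; last first.
  by move=> c /andP[nc ck]; rewrite /F bin_small ?mulr0 //; lia.
rewrite -(@sum_ord_widen _ k.+1 _ F) ?ltnS ?leq_addl // => c /andP[kc _].
by rewrite /F block_sum_gt ?mul0r.
Qed.

Lemma recip_sum_blocks k n : eqmodpq p r (recip_sum p k.+1 (n * q))
  (\sum_(c < k.+1) block_sum k.+1 c * 'C(n + k - c, k)%:R).
Proof.
have := pdvdW (leq_addr r r) (recip_sum_expand k n).
rewrite sum_block_sum opprB addrA addrAC rpredDr // pdvdMr ?pdvd_nat //.
apply: rpred_sum => c _.
by rewrite rpredM ?sq_block_sum_pint ?rpredM ?rpred_nat.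
Qed.

Lemma recip_sum_blocks_dvd k n : (p %| n)%N -> (k < p)%N ->
  eqmodpq p r.+1 (recip_sum p k.+1 (n * q))
    (\sum_(c < k.+1) block_sum k.+1 c * 'C(n + k - c, k)%:R).
Proof.
move=> pn kp; have := pdvdW (leq_add r_gt0 (leqnn r)) (recip_sum_expand k n).
rewrite sum_block_sum opprB addrA addrAC rpredDr //.
rewrite mulrC pdvdM ?pdvd_nat // rpred_sum // => c _.
have [kc|ck] := ltnP k c; first by rewrite sq_block_sum_gt ?mul0r ?rpred0.
case: (posnP c) => [->|c_gt0]; first by rewrite sq_block_sum0 mul0r rpred0.
rewrite pdvdMl ?sq_block_sum_pint // pdvdMnl //; have cn := ltn_ord c.
have -> : (n - c + k = n + (k - c))%N by lia.
by rewrite bin_addn_pdvd ?expn1 //; lia.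
Qed.

Lemma block_sum_rev k c : (c <= k)%N ->
  eqmodpq p r (block_sum k (k - c)) ((-1) ^+ k * block_sum k c).
Proof.
move=> ck; pose S : {poly rat} :=
  \poly_(i < q.+1) (if coprime (q - i) p then (q - i)%:R^-1 else 0).
have revE : recip_poly p q = recip_poly p q.+1.
  apply/polyP=> i; rewrite !coef_poly ltnS; case: ltngtP => // ->.
  by rewrite coprime_sym prime_coprime // p_dvd_q.
have block_revE : block_sum k (k - c) = (S ^+ k)`_(c * q).
  rewrite /block_sum revE coef_expr_rev ?leq_mul2r ?leq_subr ?orbT //.
  by rewrite -mulnBl subKn.
have pS : S \is a polyOver (pint p).
  by apply: polyOver_poly => i _; case: ifP => [/pint_invn|] //; rewrite rpred0.
have pSN : S - (- recip_poly p q) \is a polyOver (pdvd p r).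
  apply/polyOverP=> i; rewrite opprK revE coefD !coef_poly ltnS.
  case: leqP => [iq|_]; last by rewrite addr0 rpred0.
  rewrite coprime_subl //; case: ifP => [i_p|_]; last by rewrite addr0 rpred0.
  have qi_p : coprime (q - i) p by rewrite coprime_subl.
  have -> : (q - i)%:R^-1 + i%:R^-1 = q%:R * ((q - i)%:R^-1 * i%:R^-1) :> rat.
    have := natr_coprime_neq0 qi_p; have := natr_coprime_neq0 i_p.
    by rewrite natrB // => i0 qi0; field; rewrite i0 qi0.
  by rewrite pdvdMr ?pdvd_nat ?rpredM ?pint_invn.
have := polyOver_pdvd_subX k pS (_ : - recip_poly p q \is a polyOver (pint p)) pSN.
rewrite rpredN => /(_ (recip_poly_pint q))/polyOverP/(_ (c * q)%N).
by rewrite eqmodpqE block_revE coefB -scaleN1r exprZn coefZ.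
Qed.

Lemma recip_sum_block1 k : eqmodpq p r (recip_sum p k.+1 q) (block_sum k.+1 1).
Proof.
have := recip_sum_blocks k 1; rewrite -sum_block_sum mul1n !big_ord_recr big_ord0 /=.
by rewrite block_sum0 mul0r !add0r binn mulr1.
Qed.

Lemma recip_sum_block2 k : eqmodpq p r (recip_sum p k.+1 (2 * q))
  (k.+1%:R * block_sum k.+1 1 + block_sum k.+1 2).
Proof.
have := recip_sum_blocks k 2; rewrite -sum_block_sum !big_ord_recr big_ord0 /=.
by rewrite block_sum0 mul0r !add0r binn (binSn k) mulr1 mulrC.
Qed.

Lemma fact_recip_sum_blocks k n : (p %| n)%N -> (k < p)%N ->
  (forall c, block_sum k.+1 c \in pdvd p r.-1) ->
  eqmodpq p r.+1 (k`!%:R * recip_sum p k.+1 (n * q))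
    (n%:R * \sum_(c < k) (-1) ^+ c * c`!%:R * (k - c.+1)`!%:R * block_sum k.+1 c.+1).
Proof.
move=> pn kp pblock; have := pdvdMnl k`! (recip_sum_blocks_dvd pn kp).
rewrite eqmodpqE mulrBr big_ord_recl block_sum0 mul0r add0r mulr_sumr => blocks.
rewrite -[X in X - _](subrK (\sum_(c < k) k`!%:R
  * (block_sum k.+1 (lift ord0 c) * 'C(n + k - lift ord0 c, k)%:R))) -addrA.
apply: (rpredD blocks); rewrite mulr_sumr -sumrB rpred_sum // => c _.
have := ffact_addn_mod (s := 1) (k - c.+1) c.
rewrite expn1 => /(_ _ pn); rewrite eqmodpqE.
have -> : (k - c.+1 + c).+1 = k by have := ltn_ord c; lia.
rewrite lift0 addnBA // -bin_ffact natrM => /(pdvdM (pblock c.+1)).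
rewrite (_ : r.-1 + (1 + 1) = r.+1)%N; last by lia.
by congr (is_true (in_mem _ _)); ring.
Qed.

End Blocks.

(** * Elimination of the signs *)

(* The sum of (-1)^(i_1 + ... + i_j)/(i_1 ... i_k) over the same k-tuples as recip_sum. *)
Definition signed_recip_sum k j N : rat :=
  ((recip_poly p N.+1 \Po (- 'X)) ^+ j * recip_poly p N.+1 ^+ (k - j))`_N.

Lemma recip_polyN n : recip_poly p n \Po (- 'X)
  = \poly_(i < n) (if coprime i p then (-1) ^+ i / i%:R else 0).
Proof.
apply/polyP=> i; rewrite coef_comp_polyN !coef_poly.
by case: (i < n)%N; case: (coprime i p); rewrite ?mulr0.
Qed.

Lemma coprime_posE i : coprime_pos p i = coprime i p.
Proof. by rewrite /coprime_pos andb_idl //; apply: coprime_prime_gt0. Qed.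

Lemma sum5_prod N (F : 'I_5 -> nat -> rat) :
  sum5 p (fun i : {ffun 'I_5 -> 'I_N.+1} => \prod_k F k (i k))
    = (\prod_k \poly_(i < N.+1) (if coprime i p then F k i / i%:R else 0))`_N.
Proof.
rewrite coef_prod_poly /sum5 big_mkcondl /=; apply: eq_bigr => i _.
case: ifP => [/forallP i_p|/negbT].
  rewrite -prodf_div; apply: eq_bigr => k _.
  by have := i_p k; rewrite coprime_posE => ->.
rewrite negb_forall => /existsP[k]; rewrite coprime_posE => /negbTE ik_p.
by rewrite (bigD1 k) //= ik_p mul0r.
Qed.

Lemma sum5_signed j N : (j <= 5)%N ->
  sum5 p (fun i : {ffun 'I_5 -> 'I_N.+1} => (-1) ^+ (\sum_(k < 5 | (k < j)%N) i k)%N)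
    = signed_recip_sum 5 j N.
Proof.
move=> j5; pose F (k : 'I_5) i : rat := if (k < j)%N then (-1) ^+ i else 1.
transitivity (sum5 p (fun i : {ffun 'I_5 -> 'I_N.+1} => \prod_k F k (i k))).
  rewrite /sum5; apply: eq_bigr => i _; congr (_ / _).
  by rewrite expr_sum big_mkcond.
rewrite sum5_prod /signed_recip_sum.
rewrite (eq_bigr (fun k : 'I_5 => if (k < j)%N then recip_poly p N.+1 \Po (- 'X)
    else recip_poly p N.+1)) => [|k _]; last first.
  rewrite recip_polyN /F; case: ifP => // _.
  by apply: eq_poly => i _; rewrite div1r.
have -> // : \prod_(k < 5) (if (k < j)%N then recip_poly p N.+1 \Po (- 'X)
    else recip_poly p N.+1)
  = (recip_poly p N.+1 \Po (- 'X)) ^+ j * recip_poly p N.+1 ^+ (5 - j).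
by case: j j5 {F} => [|[|[|[|[|[|]]]]]] // _; rewrite !big_ord_recr big_ord0 /=; ring.
Qed.

Lemma signed_recip_sum_rev k j n : (j <= k)%N ->
  signed_recip_sum k (k - j) (2 * n) = signed_recip_sum k j (2 * n).
Proof.
move=> jk; rewrite /signed_recip_sum subKn //; set f := recip_poly _ _.
have -> : (f \Po (- 'X)) ^+ (k - j) * f ^+ j
    = ((f \Po (- 'X)) ^+ j * f ^+ (k - j)) \Po (- 'X).
  rewrite rmorphM !rmorphXn /= -comp_polyA rmorphN /= comp_polyX opprK comp_polyXr.
  by rewrite mulrC.
by rewrite coef_comp_polyN exprM sqrrN !expr1n mul1r.
Qed.

Lemma recip_poly_even n : odd p ->
  recip_poly p (2 * n).+1 + (recip_poly p (2 * n).+1 \Po (- 'X))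
    = recip_poly p n.+1 \Po 'X^2.
Proof.
move=> p_odd; apply/polyP=> i; rewrite coefD coef_comp_polyN coef_comp_poly_Xn //.
rewrite !coef_poly; case: (boolP (2 %| i)%N) => [/dvdnP[j ->]|i_odd]; last first.
  by rewrite -signr_odd; move: i_odd; rewrite dvdn2 negbK => ->; rewrite mulN1r subrr.
rewrite mulnK // [(j * 2)%N]mulnC !ltnS leq_pmul2l // coprimeMl coprime2n p_odd /=.
rewrite exprM sqrrN !expr1n mul1r; case: ifP => // _; case: ifP => // j_p.
by rewrite natrM; field; apply: natr_coprime_neq0.
Qed.

(* Since f(x) + f(-x) = f(x^2), only the tuples with all entries even survive. *)
Lemma sum_signed_recip_sum k n : odd p ->
  \sum_(j < k.+1) 'C(k, j)%:R * signed_recip_sum k j (2 * n) = recip_sum p k n.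
Proof.
move=> /(recip_poly_even n) f_even; rewrite /recip_sum.
have <- : ((recip_poly p n.+1 ^+ k) \Po 'X^2)`_(2 * n) = (recip_poly p n.+1 ^+ k)`_n.
  by rewrite coef_comp_poly_Xn // dvdn_mulr // mulKn.
rewrite rmorphXn /= -f_even exprDn coef_sum; apply: eq_bigr => j _.
by rewrite coefMn mulr_natl /signed_recip_sum mulrC.
Qed.

Lemma sum5_signs n : odd p ->
  5 * (sum5 p (fun i : {ffun 'I_5 -> 'I_(2 * n).+1} => (-1) ^+ (i 0%R : nat))
     + 2 * sum5 p (fun i : {ffun 'I_5 -> 'I_(2 * n).+1} => (-1) ^+ (i 0%R + i 1%R)%N))
  = recip_sum p 5 n / 2 - recip_sum p 5 (2 * n).
Proof.
move=> p_odd.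
have <- : signed_recip_sum 5 1 (2 * n)
    = sum5 p (fun i : {ffun 'I_5 -> 'I_(2 * n).+1} => (-1) ^+ (i 0%R : nat)).
  rewrite -sum5_signed //; apply: eq_bigr => i _; congr (_ ^+ _ / _).
  by rewrite big_mkcond !big_ord_recl big_ord0 /= !addn0.
have <- : signed_recip_sum 5 2 (2 * n)
    = sum5 p (fun i : {ffun 'I_5 -> 'I_(2 * n).+1} => (-1) ^+ (i 0%R + i 1%R)%N).
  rewrite -sum5_signed //; apply: eq_bigr => i _; congr (_ ^+ _ / _).
  rewrite big_mkcond !big_ord_recl big_ord0 /= !addn0; congr (_ + nat_of_ord (i _))%N.
  exact: val_inj.
have signed0 : signed_recip_sum 5 0 (2 * n) = recip_sum p 5 (2 * n).
  by rewrite /signed_recip_sum expr0 mul1r.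
have rev j := @signed_recip_sum_rev 5 j n.
rewrite -(sum_signed_recip_sum 5 n p_odd) !big_ord_recr big_ord0 /=.
rewrite (rev 0%N) // (rev 1%N) // (rev 2) // signed0 !(bin0, bin1, binn).
rewrite (_ : 'C(5, 2) = 10)%N // (_ : 'C(5, 3) = 10)%N // (_ : 'C(5, 4) = 5)%N //.
by field.
Qed.

(** * The case r = 1 *)

Section LargePrime.

Hypothesis p_gt5 : (5 < p)%N.

Let p_odd : odd p.
Proof. by case: (even_prime p_pr) p_gt5 => // ->. Qed.

Let coprime_le5 i : (0 < i <= 5)%N -> coprime i p.
Proof. by case/andP=> i_gt0 i5; rewrite coprime_small // i_gt0 (leq_ltn_trans i5). Qed.

Let B := bernoulli (p - 5).

Lemma power_sum2_recips m : power_sum (recips p (m * p)) 2 \in pdvd p 1.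
Proof.
have mod_mul := power_sum_recips_mul_prime m p_odd (isT : ~~ odd 2).
rewrite (pdvd_eqmodpq (leqnSn 1) mod_mul) pdvdMnl //.
apply: (@pdvd_cancel 3); first exact: coprime_le5.
have k_p : (0 < 2 < p.-1)%N by lia.
rewrite (pdvd_eqmodpq (leqnSn 1) (power_sum_recips_bernoulli k_p)) pdvdMnl //.
by rewrite pdvdMr ?pdvd_prime ?bernoulli_pint //; lia.
Qed.

Lemma power_sum1_recips m : power_sum (recips p (m * p)) 1 \in pdvd p 2.
Proof.
have pmp : (p ^ 1 %| m * p)%N by rewrite dvdn_mull.
apply: (@pdvd_cancel 2); first exact: coprime_le5.
have := pdvdW (leqnSn 2) (@power_sum_recips_odd 1 _ 0 p_odd isT pmp).
by rewrite mul1r rpredDr // (@pdvdM 1 1) ?pdvd_mul_prime ?power_sum2_recips.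
Qed.

Lemma power_sum4_recips m :
  eqmodpq p 2 (5 * power_sum (recips p (m * p)) 4) (4 * m%:R * p%:R * B).
Proof.
have four_p : (0 < 4 < p.-1)%N by lia.
have mod_p4 := power_sum_recips_bernoulli four_p.
rewrite (_ : p.-1 - 4 = p - 5)%N -/B in mod_p4; last by lia.
have mod_mul := power_sum_recips_mul_prime m p_odd (isT : ~~ odd 4).
rewrite !eqmodpqE in mod_p4 mod_mul *.
have -> : 5 * power_sum (recips p (m * p)) 4 - 4 * m%:R * p%:R * B
  = 5 * (power_sum (recips p (m * p)) 4 - m%:R * power_sum (recips p p) 4)
    + m%:R * (5 * power_sum (recips p p) 4 - 4 * (p%:R * B)) by ring.
by rewrite rpredD ?pdvdMnl.
Qed.

Lemma power_sum3_recips m :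
  eqmodpq p 3 (5 * power_sum (recips p (m * p)) 3) (- (6 * m%:R ^+ 2 * p%:R ^+ 2 * B)).
Proof.
rewrite eqmodpqE opprK; have mod_p4 := power_sum4_recips m; rewrite eqmodpqE in mod_p4.
have pmp : (p ^ 1 %| m * p)%N by rewrite dvdn_mull.
apply: (@pdvd_cancel 2); first exact: coprime_le5.
have -> : 2 * (5 * power_sum (recips p (m * p)) 3 + 6 * m%:R ^+ 2 * p%:R ^+ 2 * B)
  = 5 * (2 * power_sum (recips p (m * p)) 3
         + 3 * (m * p)%:R * power_sum (recips p (m * p)) 4)
    - 3 * ((m * p)%:R * (5 * power_sum (recips p (m * p)) 4 - 4 * m%:R * p%:R * B)).
  by rewrite natrM; ring.
apply: rpredB; first exact/pdvdMnl/(@power_sum_recips_odd 1 _ 1).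
by apply/pdvdMnl/(@pdvdM 1 2); rewrite ?pdvd_mul_prime.
Qed.

Lemma elem_sym_recips m :
  eqmodpq p 3 (5 * elem_sym (recips p (m * p)) 3) (- (2 * m%:R ^+ 2 * p%:R ^+ 2 * B)) /\
  eqmodpq p 2 (5 * elem_sym (recips p (m * p)) 4) (- (m%:R * p%:R * B)).
Proof.
have [|e3 e4] := elem_sym_mod_power_sum _ (@recips_pint (m * p))
  (power_sum1_recips m) (power_sum2_recips m); first by lia.
have mod_p3 := power_sum3_recips m; have mod_p4 := power_sum4_recips m.
rewrite !eqmodpqE !opprK in e3 e4 mod_p3 mod_p4 *; split.
  apply: (@pdvd_cancel 3); first exact: coprime_le5.
  have := rpredD (pdvdMnl 5 e3) mod_p3.
  by congr (is_true (in_mem _ _)); ring.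
apply: (@pdvd_cancel 4); first exact: coprime_le5.
have := rpredB (pdvdMnl 5 e4) mod_p4.
by congr (is_true (in_mem _ _)); ring.
Qed.

Lemma recip_sum_prime_mod : eqmodpq p 1 (recip_sum p 5 p) (- 24 * B).
Proof.
have p0 : p%:R != 0 :> rat by rewrite pnatr_eq0 -lt0n prime_gt0.
have [_] := elem_sym_recips 1; rewrite !eqmodpqE mul1n => e4.
rewrite recip_sum_prime // recip_sum1 ?prime_gt0 //.
have /(perm_elem_sym 4) := perm_recips1_mul 1; rewrite mul1n /= => ->.
set e := elem_sym _ 4 in e4 *.
have -> : 5`!%:R / p%:R * e - - 24 * B = 24 * (5 * e - - (1 * p%:R * B)) / (p ^ 1)%:R.
  by rewrite (_ : 5`! = 120)%N // expn1; field.
by rewrite pdvd_divX pdvdMnl.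
Qed.

Lemma recip_sum_double_prime_mod : eqmodpq p 1 (recip_sum p 5 (2 * p)) (- 72 * B).
Proof.
have p_gt0 := prime_gt0 p_pr.
have p0 : p%:R != 0 :> rat by rewrite pnatr_eq0 -lt0n.
have [pe3 _] := elem_sym_recips 1; have [pe3' pe4'] := elem_sym_recips 2.
rewrite eqmodpqE recip_sum_double_prime //= !recip_sum1 ?muln_gt0 //.
have /(perm_elem_sym 3) := perm_recips1_mul 1; rewrite mul1n /= => ->.
have /(perm_elem_sym 4) := perm_recips1_mul 2; rewrite /= invr1 mulr1 => ->.
rewrite elem_symS_cons; rewrite !eqmodpqE !opprK mul1n in pe3 pe3' pe4'.
set e3 := elem_sym _ 3 in pe3 *; set e3' := elem_sym _ 3 in pe3' *.
set e4' := elem_sym _ 4 in pe4' *.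
have -> : 5`!%:R / (2 * p)%:R * (e4' + p%:R^-1 * e3') - 5%:R / p%:R * (4`!%:R / p%:R * e3)
    - - 72 * B
  = (12 * (p%:R * (5 * e4' + 2 * p%:R * B)) + 12 * (5 * e3' + 2 * 2 ^+ 2 * p%:R ^+ 2 * B)
     - 24 * (5 * e3 + 2 * 1 ^+ 2 * p%:R ^+ 2 * B)) / (p ^ 2)%:R.
  by rewrite (_ : 5`! = 120)%N // (_ : 4`! = 24)%N // natrM natrX; field.
rewrite pdvd_divX; apply: rpredB; last exact: pdvdMnl.
by apply: rpredD; apply: pdvdMnl => //; apply: (@pdvdM 1 2); rewrite ?pdvd_prime.
Qed.

(** * From p^r to p^(r+1) *)

Lemma block_sum5_pdvd r c : (0 < r)%N ->
  recip_sum p 5 (p ^ r) \in pdvd p r.-1 -> recip_sum p 5 (2 * p ^ r) \in pdvd p r.-1 ->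
  block_sum r 5 c \in pdvd p r.-1.
Proof.
move=> r_gt0 pZ1 pZ2; have lower x : x \in pdvd p r -> x \in pdvd p r.-1.
  exact/pdvdW/leq_pred.
have S1 : block_sum r 5 1 \in pdvd p r.-1.
  by have := lower _ (recip_sum_block1 r_gt0 4); rewrite rpredBl.
have S2 : block_sum r 5 2 \in pdvd p r.-1.
  by have := lower _ (recip_sum_block2 r_gt0 4); rewrite rpredBl // rpredDl ?pdvdMnl.
have rev j : (j <= 5)%N -> block_sum r 5 j \in pdvd p r.-1 ->
    block_sum r 5 (5 - j) \in pdvd p r.-1.
  move=> j5 Sj; have := lower _ (block_sum_rev r_gt0 j5).
  by rewrite rpredBr // pdvdMl ?rpredX ?rpredN ?rpred1.
case: c => [|[|[|[|[|c]]]]] //; first by rewrite block_sum0 rpred0.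
- exact: (rev 2).
- exact: (rev 1%N).
- by rewrite block_sum_gt ?rpred0.
Qed.

(* The reversal i -> q - i turns the four block sums into two, which are read off from the
   sums of total q and 2 q. *)
Lemma recip_sum_step r m : (0 < r)%N ->
  recip_sum p 5 (p ^ r) \in pdvd p r.-1 -> recip_sum p 5 (2 * p ^ r) \in pdvd p r.-1 ->
  eqmodpq p r.+1 (6 * recip_sum p 5 (m * p * p ^ r))
    ((m * p)%:R * (8 * recip_sum p 5 (p ^ r) - recip_sum p 5 (2 * p ^ r))).
Proof.
move=> r_gt0 pZ1 pZ2.
have blocks := fact_recip_sum_blocks r_gt0 (dvdn_mull m (dvdnn p)) (ltnW p_gt5)
  (fun c => block_sum5_pdvd c r_gt0 pZ1 pZ2).
have e1 := recip_sum_block1 r_gt0 4; have e2 := recip_sum_block2 r_gt0 4.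
have e3 := block_sum_rev r_gt0 (isT : 2 <= 5)%N.
have e4 := block_sum_rev r_gt0 (isT : 1 <= 5)%N.
have sumE : \sum_(c < 4) (-1) ^+ c * c`!%:R * (4 - c.+1)`!%:R * block_sum r 5 c.+1
    = 6 * block_sum r 5 1 - 2 * block_sum r 5 2
      + 2 * block_sum r 5 3 - 6 * block_sum r 5 4.
  by rewrite !big_ord_recr big_ord0 /= !subSS !subn0 !factS fact0; ring.
rewrite sumE (_ : 4`! = 24)%N // in blocks.
rewrite (_ : 5 - 2 = 3)%N // in e3; rewrite (_ : 5 - 1 = 4)%N // in e4.
rewrite !eqmodpqE in blocks e1 e2 e3 e4 *.
apply: (@pdvd_cancel 4); first exact: coprime_le5.
have := rpredD (pdvdMnl 4 e2)
  (rpredB (pdvdMnl 2 e3) (rpredD (pdvdMnl 6 e4) (pdvdMnl 32 e1))).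
move/(pdvdM (pdvd_mul_prime m))/(rpredD blocks).
by congr (is_true (in_mem _ _)); ring.
Qed.

Lemma expn_bernoulli_pdvd k : (p ^ k)%:R * B \in pdvd p k.
Proof. by rewrite pdvdMr ?pdvd_nat ?bernoulli_pint //; lia. Qed.

Lemma recip_sum_lift k m (a b : rat) :
  a \in pint p -> b \in pint p -> 8 * a - b = - 120 ->
  eqmodpq p k.+1 (recip_sum p 5 (p ^ k.+1)) (a * ((p ^ k)%:R * B)) ->
  eqmodpq p k.+1 (recip_sum p 5 (2 * p ^ k.+1)) (b * ((p ^ k)%:R * B)) ->
  eqmodpq p k.+2 (recip_sum p 5 (m * p ^ k.+2)) (- 20 * m%:R * ((p ^ k.+1)%:R * B)).
Proof.
move=> pa pb abE Z1 Z2.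
have pZ1 : recip_sum p 5 (p ^ k.+1) \in pdvd p k.
  by rewrite (pdvd_eqmodpq (leqnSn k) Z1) (pdvdMl pa (expn_bernoulli_pdvd k)).
have pZ2 : recip_sum p 5 (2 * p ^ k.+1) \in pdvd p k.
  by rewrite (pdvd_eqmodpq (leqnSn k) Z2) (pdvdMl pb (expn_bernoulli_pdvd k)).
have := recip_sum_step m (ltn0Sn k) pZ1 pZ2.
rewrite -mulnA -expnS !eqmodpqE in Z1 Z2 * => step.
apply: (@pdvd_cancel 6); first by rewrite (coprimeMl p 2 3) !coprime_le5.
move/pdvdMnl: (rpredB (pdvdMnl 8 Z1) Z2) => /(_ m)/(pdvdM pdvd_prime)/(rpredD step).
congr (is_true (in_mem _ _)).
rewrite (_ : b = 8 * a + 120); last by rewrite -[120]opprK -abE; ring.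
by rewrite [in RHS](expnS p k); ring.
Qed.

Lemma recip_sum_expn k m :
  eqmodpq p k.+2 (recip_sum p 5 (m * p ^ k.+2)) (- 20 * m%:R * ((p ^ k.+1)%:R * B)).
Proof.
elim: k m => [|k IHk] m.
  have := @recip_sum_lift 0 m (- 24) (- 72); rewrite expn0 expn1 mul1r; apply.
  - by rewrite rpredN rpred_nat.
  - by rewrite rpredN rpred_nat.
  - by ring.
  - exact: recip_sum_prime_mod.
  - exact: recip_sum_double_prime_mod.
apply: (@recip_sum_lift k.+1 m (- 20) (- 40)).
- by rewrite rpredN rpred_nat.
- by rewrite rpredN rpred_nat.
- by ring.
- by have := IHk 1%N; rewrite mul1n mulr1.
- exact: IHk 2.
Qed.

End LargePrime.

End PrimeModulus.

Theorem theorem4 (p r : nat) (p_prime : prime p) (p_gt5 : (5 < p)%N)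
    (r_gt0 : (0 < r)%N) :
  let S : rat :=
    @sum5 p (2 * p ^ r) (fun i => (-1) ^+ (i 0%R : nat))
    + 2 * @sum5 p (2 * p ^ r) (fun i => (-1) ^+ (i 0%R + i 1%R)%N) in
  (r = 1%N -> eqmodpq p 1 S (12 * bernoulli (p - 5))) /\
  ((1 < r)%N ->
     eqmodpq p r S (6 * (p ^ r.-1)%:R * bernoulli (p - 5))).
Proof.
move=> S; have p_odd : odd p by case: (even_prime p_prime) p_gt5 => // ->.
have S_mod x y z : eqmodpq p r (recip_sum p 5 (p ^ r)) x ->
    eqmodpq p r (recip_sum p 5 (2 * p ^ r)) y -> x - 2 * y = 10 * z -> eqmodpq p r S z.
  rewrite !eqmodpqE => Zx Zy xyz; apply: (pdvd_cancel p_prime (i := 10)).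
    by rewrite (coprimeMl p 2 5) coprime2n p_odd coprime_small.
  rewrite mulrBr -xyz (_ : 10 * S = 2 * (5 * S)); last by ring.
  rewrite sum5_signs //; have := rpredB Zx (pdvdMnl p_prime 2 Zy).
  by congr (is_true (in_mem _ _)); field.
case: r r_gt0 @S S_mod => [|[|k]] // _ S S_mod; split=> // _.
  apply: S_mod (recip_sum_prime_mod p_prime p_gt5)
    (recip_sum_double_prime_mod p_prime p_gt5) _.
  by ring.
have := recip_sum_expn p_prime p_gt5 k; rewrite /= => Z_mod.
apply: (S_mod _ _ _ _ (Z_mod 2)); first by rewrite -[(p ^ _)%N]mul1n; apply: Z_mod.
by ring.
Qed.
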